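(* Let $M$ be a hyperkähler manifold with complex structures $I,J,K$ and Kähler forms $\omega_I,\omega_J,\omega_K$. Then the generalized almost complex structure $\mathcal{J}_t=\sin t\,\mathcal{J}_I+\cos t\,\mathcal{J}_{\omega_J}$ is integrable for all $t\in[0,\frac{\pi}{2}]$. Therefore it is a family of generalized complex structures interpolating between a symplectic structure (at $t=0$) and a complex structure (at $t=\frac\pi2$).
   Context: $T\oplus T^*$ carries the inner product $\langle X+\xi,Y+\eta\rangle=\frac12(\xi(Y)+\eta(X))$ and the Courant bracket $[X+\xi,Y+\eta]=[X,Y]+\mathcal{L}_X\eta-\mathcal{L}_Y\xi-\frac12 d(i_X\eta-i_Y\xi)$. A generalized almost complex structure is an orthogonal endomorphism $\mathcal{J}$ of $T\oplus T^*$ with $\mathcal{J}^2=-1$; it is integrable (a generalized complex structure) if the sections of its $+i$-eigenbundle in $(T\oplus T^* )\otimes\mathbb{C}$ are closed under the Courant bracket. A hyperkähler manifold has a Riemannian metric $g$ and complex structures $I,J,K$, each Kähler with respect to the same metric $g$, satisfying $IJ=K=-JI$. The Kähler forms are $\omega_I=gI$, $\omega_J=gJ$, $\omega_K=gK$ (i.e. $\omega_I(X,Y)=g(IX,Y)$, etc.). In block form on $T\oplus T^*$, $\mathcal{J}_I=\begin{pmatrix}-I&0\\0&I^*\end{pmatrix}$ and $\mathcal{J}_{\omega_J}=\begin{pmatrix}0&-\omega_J^{-1}\\ \omega_J&0\end{pmatrix}$, where $\omega_J:T\to T^*$ is $X\mapsto i_X\omega_J$. *)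

(* Defs.v *)
From mathcomp Require Import all_boot all_order all_algebra.
From mathcomp Require Import all_classical all_reals all_analysis.
From mathcomp Require Import complex.

Set Implicit Arguments.
Unset Strict Implicit.
Unset Printing Implicit Defensive.

Import Order.TTheory GRing.Theory Num.Theory.
Import numFieldNormedType.Exports.

Local Open Scope classical_set_scope.
Local Open Scope ring_scope.

(* Points of R^n, tangent vectors and covectors are all column vectors, so that
   block matrices act on (X; xi) in T (+) T^* as written on paper. *)

Section Calculus.
Context {R : realType} {n : nat}.
Implicit Types (U : set 'cV[R]_n).

Definition partial (i : 'I_n) (f : 'cV[R]_n -> R) (x : 'cV[R]_n) : R :=
  'D_(delta_mx i 0) f x.

Fixpoint Ck (k : nat) U (f : 'cV[R]_n -> R) : Prop :=
  if k is k'.+1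
  then (forall x, U x -> differentiable f x)
       /\ (forall i, Ck k' U (partial i f))
  else forall x, U x -> {for x, continuous f}.

Definition smooth U (f : 'cV[R]_n -> R) : Prop := forall k, Ck k U f.

Definition smooth_mx p q U (F : 'cV[R]_n -> 'M[R]_(p, q)) : Prop :=
  forall i j, smooth U (fun x => F x i j).

Definition smooth_mxC p q U (F : 'cV[R]_n -> 'M[R[i]]_(p, q)) : Prop :=
  forall i j, smooth U (fun x => complex.Re (F x i j))
           /\ smooth U (fun x => complex.Im (F x i j)).

Definition jac (F : 'cV[R]_n -> 'cV[R]_n) (x : 'cV[R]_n) : 'M[R]_n :=
  \matrix_(i, j) partial j (fun y => F y i 0) x.

Definition partialC (i : 'I_n) (f : 'cV[R]_n -> R[i]) (x : 'cV[R]_n) : R[i] :=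
  (partial i (fun y => complex.Re (f y)) x
    +i* partial i (fun y => complex.Im (f y)) x)%C.

End Calculus.

(* The operations of the Courant bracket in local coordinates, extended
   complex-(bi)linearly to sections of T (x) C and T^* (x) C. *)
Section CourantBracket.
Context {R : realType} {n : nat}.
Local Notation vfun := ('cV[R]_n -> 'cV[R[i]]_n).

Definition lie_bracket (X Y : vfun) : vfun := fun x =>
  \col_j \sum_i (X x i 0 * partialC i (fun y => Y y j 0) x
               - Y x i 0 * partialC i (fun y => X y j 0) x).

Definition lie_deriv_form (X eta : vfun) : vfun := fun x =>
  \col_j \sum_i (X x i 0 * partialC i (fun y => eta y j 0) x
               + eta x i 0 * partialC j (fun y => X y i 0) x).

Definition contraction (X eta : vfun) : 'cV[R]_n -> R[i] := fun x =>
  \sum_i eta x i 0 * X x i 0.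

Definition ext_diff (f : 'cV[R]_n -> R[i]) : vfun := fun x =>
  \col_j partialC j f x.

Definition courant (a b : 'cV[R]_n -> 'cV[R[i]]_(n + n)) :
    'cV[R]_n -> 'cV[R[i]]_(n + n) :=
  let X x := usubmx (a x) in let xi x := dsubmx (a x) in
  let Y x := usubmx (b x) in let eta x := dsubmx (b x) in
  fun x => col_mx (lie_bracket X Y x)
    (lie_deriv_form X eta x - lie_deriv_form Y xi x
      - 2^-1 *: ext_diff (fun y => contraction X eta y - contraction Y xi y) x).

End CourantBracket.

(* A smooth n-manifold without boundary, presented by a smooth atlas. The maps
   are total; [coord i] and [param i] are mutually inverse homeomorphisms
   between [dom i] and its image, and are unconstrained elsewhere. *)
Record manifold (R : realType) (n : nat) := Manifold {
  carrier :> topologicalType;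
  manifold_hausdorff : hausdorff_space carrier;
  manifold_second_countable : @second_countable carrier;
  chart : Type;
  dom : chart -> set carrier;
  coord : chart -> carrier -> 'cV[R]_n;
  param : chart -> 'cV[R]_n -> carrier;
  dom_open : forall i, open (dom i);
  dom_cover : forall p, exists i, dom i p;
  coord_open : forall i, open (coord i @` dom i);
  coordK : forall i p, dom i p -> param i (coord i p) = p;
  coord_continuous : forall i p, dom i p -> {for p, continuous (coord i)};
  param_continuous : forall i x, (coord i @` dom i) x ->
    {for x, continuous (param i)};
  transition_smooth : forall i j,
    smooth_mx (coord i @` (dom i `&` dom j)) (coord j \o param i)
}.

Section Manifold.
Context {R : realType} {n : nat} {M : manifold R n}.
Implicit Types (i j : chart M) (x : 'cV[R]_n).

Definition img i : set 'cV[R]_n := coord i @` dom i.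
Definition overlap i j : set 'cV[R]_n := coord i @` (dom i `&` dom j).
Definition transition i j : 'cV[R]_n -> 'cV[R]_n := coord j \o param i.

(* Tensor fields are given by their components in every chart, subject to the
   usual transformation laws; the component functions in the chart [i] are
   meaningful on [img i] only. *)
Definition components (V : Type) := chart M -> 'cV[R]_n -> V.

(* Action of a change of coordinates with Jacobian A on T (+) T^*. *)
Definition gen_change (A : 'M[R]_n) : 'M[R]_(n + n) :=
  block_mx A 0 0 (invmx A)^T.

Definition complexify p q (A : 'M[R]_(p, q)) : 'M[R[i]]_(p, q) :=
  map_mx (real_complex R) A.

Definition is_endo (F : components 'M[R]_n) : Prop :=
  (forall i, smooth_mx (img i) (F i))
  /\ (forall i j x, overlap i j x ->
        let A := jac (transition i j) x in
        F j (transition i j x) *m A = A *m F i x).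

(* A covariant 2-tensor b is represented by the matrix of the map
   X |-> b(X, _) from T to T^*, so that b(X, Y) = Y^T B X. *)
Definition is_bilin (B : components 'M[R]_n) : Prop :=
  (forall i, smooth_mx (img i) (B i))
  /\ (forall i j x, overlap i j x ->
        let A := jac (transition i j) x in
        B i x = A^T *m B j (transition i j x) *m A).

Definition is_gen_endo (F : components 'M[R]_(n + n)) : Prop :=
  (forall i, smooth_mx (img i) (F i))
  /\ (forall i j x, overlap i j x ->
        let A := gen_change (jac (transition i j) x) in
        F j (transition i j x) *m A = A *m F i x).

(* Smooth global sections of (T (+) T^* ) (x) C. *)
Definition is_gen_section (s : components 'cV[R[i]]_(n + n)) : Prop :=
  (forall i, smooth_mxC (img i) (s i))
  /\ (forall i j x, overlap i j x ->
        s j (transition i j x)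
        = complexify (gen_change (jac (transition i j) x)) *m s i x).

Definition pairing (u v : 'cV[R]_(n + n)) : R :=
  2^-1 * (((dsubmx u)^T *m usubmx v) 0 0 + ((dsubmx v)^T *m usubmx u) 0 0).

Definition is_gen_almost_complex (F : components 'M[R]_(n + n)) : Prop :=
  [/\ is_gen_endo F,
      forall i x, img i x ->
        forall u v, pairing (F i x *m u) (F i x *m v) = pairing u v
    & forall i x, img i x -> F i x *m F i x = - 1%:M].

Definition plus_i_section (F : components 'M[R]_(n + n))
    (s : components 'cV[R[i]]_(n + n)) : Prop :=
  is_gen_section s
  /\ forall i x, img i x -> complexify (F i x) *m s i x = 'i%C *: s i x.

Definition integrable_gen (F : components 'M[R]_(n + n)) : Prop :=
  forall a b, plus_i_section F a -> plus_i_section F b ->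
    plus_i_section F (fun i => courant (a i) (b i)).

Definition is_gen_complex (F : components 'M[R]_(n + n)) : Prop :=
  is_gen_almost_complex F /\ integrable_gen F.

(* Multiplication by the imaginary unit on R^2 (+) ... (+) R^2 :
   e_(2k) |-> e_(2k+1) and e_(2k+1) |-> - e_(2k). *)
Definition std_complex : 'M[R]_n :=
  \matrix_(i, j) (((i == j.+1 :> nat) && ~~ odd j)%:R
                - ((j == i.+1 :> nat) && ~~ odd i)%:R).

(* A complex structure is an almost complex structure which becomes the
   standard one in suitable (holomorphic) coordinates H around every point. *)
Definition is_complex_structure (I : components 'M[R]_n) : Prop :=
  [/\ is_endo I,
      forall i x, img i x -> I i x *m I i x = - 1%:M
    & forall i x, img i x ->
        exists (V : set 'cV[R]_n) (H : 'cV[R]_n -> 'cV[R]_n),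
        [/\ open V, V x & V `<=` img i] /\
        [/\ smooth_mx V H,
            forall y z, V y -> V z -> H y = H z -> y = z,
            forall y, V y -> jac H y \in unitmx
          & forall y, V y -> jac H y *m I i y = std_complex *m jac H y]].

Definition is_riemannian (g : components 'M[R]_n) : Prop :=
  [/\ is_bilin g,
      forall i x, img i x -> (g i x)^T = g i x
    & forall i x, img i x ->
        forall v : 'cV[R]_n, v != 0 -> 0 < (v^T *m g i x *m v) 0 0].

Definition is_2form (w : components 'M[R]_n) : Prop :=
  is_bilin w /\ forall i x, img i x -> (w i x)^T = - w i x.

(* The component (d w)(e_a, e_b, e_c), where w(e_a, e_b) is [w i x b a]. *)
Definition closed_2form (w : components 'M[R]_n) : Prop :=
  forall i x, img i x -> forall a b c : 'I_n,
    partial a (fun y => w i y c b) x + partial b (fun y => w i y a c) x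
    + partial c (fun y => w i y b a) x = 0.

Definition is_symplectic_form (w : components 'M[R]_n) : Prop :=
  [/\ is_2form w, closed_2form w & forall i x, img i x -> w i x \in unitmx].

(* X |-> i_X w for w(X, Y) = g(I X, Y). *)
Definition kahler_form (g I : components 'M[R]_n) : components 'M[R]_n :=
  fun i x => g i x *m I i x.

Definition is_kahler (g I : components 'M[R]_n) : Prop :=
  [/\ is_riemannian g, is_complex_structure I,
      forall i x, img i x -> (I i x)^T *m g i x *m I i x = g i x
    & closed_2form (kahler_form g I)].

Definition is_hyperkahler (g I J K : components 'M[R]_n) : Prop :=
  [/\ is_kahler g I, is_kahler g J, is_kahler g K,
      forall i x, img i x -> I i x *m J i x = K i x
    & forall i x, img i x -> K i x = - (J i x *m I i x)].

Definition gen_of_complex (I : components 'M[R]_n) :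
    components 'M[R]_(n + n) :=
  fun i x => block_mx (- I i x) 0 0 (I i x)^T.

Definition gen_of_symplectic (w : components 'M[R]_n) :
    components 'M[R]_(n + n) :=
  fun i x => block_mx 0 (- invmx (w i x)) (w i x) 0.

Definition interpolation (g I J : components 'M[R]_n) (t : R) :
    components 'M[R]_(n + n) :=
  fun i x => sin t *: gen_of_complex I i x
           + cos t *: gen_of_symplectic (kahler_form g J) i x.

End Manifold.

(* Main.v *)
(* Write s = sin t and c = cos t. The quaternionic relations give
   wJ I = I^* wJ = - wK and I^* wK = wJ, from which J_t is orthogonal with square
   -1, and determine its +i-eigenbundle L_t.
   If c <> 0, then L_t is the graph { X + Om X } of the complex 2-form
   Om = (s wK - i wJ) / c. If c = 0, hence s = 1, then
   L_t = ker Om (+) im Om for Om = wK - i wJ; this Om is the holomorphic symplectic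
   form of I, and xi = Om Z with Z = (i/2) wJ^-1 xi when xi is in im Om.
   In both cases Om is closed, and Cartan's formula
   L_X i_W Om = i_[X,W] Om + i_W d (i_X Om) shows that L_t is closed under the
   Courant bracket: [X + Om X, Y + Om Y] = [X,Y] + Om [X,Y] for a graph, while
   [X + Om Z, Y + Om W] = [X,Y] + Om ([X,W] - [Y,Z]) with Om [X,Y] = 0 when X and Y
   lie in ker Om. That the bracket of two global sections is again a global section
   is its naturality under changes of coordinates, where the second derivatives of
   the transition maps cancel by symmetry. *)
Require Import Defs.
From mathcomp Require Import all_boot all_order all_algebra.
From mathcomp Require Import all_classical all_reals all_analysis.
From mathcomp Require Import complex ring.

Set Implicit Arguments.
Unset Strict Implicit.
Unset Printing Implicit Defensive.

Import Order.TTheory GRing.Theory Num.Theory.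
Import numFieldNormedType.Exports.

Local Open Scope classical_set_scope.
Local Open Scope ring_scope.

(** * Smooth functions *)

Section NearDifferentiable.
Context {R : numFieldType} {V W : normedModType R}.

(** The first-order expansion of [f] at [x] is a local condition, hence also one for [g]; uniqueness
    of the differential then identifies its linear part with ['d g x]. *)
Lemma near_eq_differentiable (f g : V -> W) (x : V) :
  (\forall y \near x, f y = g y) -> differentiable f x -> differentiable g x.
Proof.
move=> fg df.
have [dc /eqaddoP fo] := (@diff_locallyP _ _ _ x f).1 df.
have go : g \o shift x = cst (g x) + 'd f x +o_ (0 : V) id.
  apply/eqaddoP => e e0; have := fo e e0.
  have fg0 : \forall h \near (0 : V), f (h + x) = g (h + x).
    by move: fg; rewrite (near_shift 0) /= subr0.
  apply: filterS2 fg0 => h /= fgh.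
  by rewrite !fctE /= fgh (nbhs_singleton fg).
apply/diff_locallyP.
by rewrite (diff_unique dc go).
Qed.

End NearDifferentiable.

Section RealCalculus.
Context {R : realType} {n : nat}.
Implicit Types (U : set 'cV[R]_n) (f g : 'cV[R]_n -> R) (x : 'cV[R]_n).

Lemma partial_near_eq i f g x :
  (\forall y \near x, f y = g y) -> partial i f x = partial i g x.
Proof. exact: near_eq_derive. Qed.

Lemma partialD i f g x : differentiable f x -> differentiable g x ->
  partial i (fun y => f y + g y) x = partial i f x + partial i g x.
Proof. by move=> df dg; apply: deriveD; exact: diff_derivable. Qed.

Lemma partialN i f x : differentiable f x ->
  partial i (fun y => - f y) x = - partial i f x.
Proof. by move=> df; apply: deriveN; exact: diff_derivable. Qed.

Lemma partialM i f g x : differentiable f x -> differentiable g x ->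
  partial i (fun y => f y * g y) x = f x * partial i g x + g x * partial i f x.
Proof. by move=> df dg; apply: deriveM; exact: diff_derivable. Qed.

Lemma partialV i f x : f x != 0 -> differentiable f x ->
  partial i (fun y => (f y)^-1) x = - (f x) ^- 2 * partial i f x.
Proof. by move=> f0 df; apply: deriveV => //; exact: diff_derivable. Qed.

Lemma partial_cst i (c : R) x : partial i (fun _ => c) x = 0.
Proof. exact: derive_cst. Qed.

Lemma colE_delta (v : 'cV[R]_n) : v = \sum_i v i 0 *: delta_mx i 0.
Proof. by rewrite [LHS]matrix_sum_delta; apply: eq_bigr => i _; rewrite big_ord1. Qed.

Lemma diff_partial f x (v : 'cV[R]_n) : differentiable f x ->
  'd f x v = \sum_i v i 0 * partial i f x.
Proof.
move=> df; rewrite {1}(colE_delta v) linear_sum; apply: eq_bigr => i _.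
by rewrite linearZ /partial deriveE.
Qed.

Lemma differentiable_cV (F : 'cV[R]_n -> 'cV[R]_n) x :
  (forall i, differentiable (fun y => F y i 0) x) -> differentiable F x.
Proof.
move=> dF; suff -> : F = \sum_i (fun y => F y i 0 *: delta_mx i 0).
  by apply: differentiable_sum => i; exact: differentiableZl.
by apply/funext => y; rewrite fct_sumE -colE_delta.
Qed.

Lemma diff_cV (F : 'cV[R]_n -> 'cV[R]_n) x v i :
  differentiable F x -> 'd F x v i 0 = 'd (fun y => F y i 0) x v.
Proof.
move=> dF; rewrite -!deriveE //; last first.
  by apply: (@differentiable_comp _ _ _ _ F (fun v : 'cV[R]_n => v i 0)) => //;
    exact: differentiable_coord.
by rewrite derive_mx ?mxE //; exact: diff_derivable.
Qed.

Lemma differentiable_comp_cV f (F : 'cV[R]_n -> 'cV[R]_n) x :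
  (forall i, differentiable (fun y => F y i 0) x) ->
  differentiable f (F x) -> differentiable (fun y => f (F y)) x.
Proof. by move=> /differentiable_cV dF df; exact: differentiable_comp. Qed.

Lemma partial_comp j f (F : 'cV[R]_n -> 'cV[R]_n) x :
  (forall i, differentiable (fun y => F y i 0) x) -> differentiable f (F x) ->
  partial j (fun y => f (F y)) x = \sum_i partial i f (F x) * jac F x i j.
Proof.
move=> dFi df; have dF := differentiable_cV dFi.
rewrite /partial deriveE; last exact: differentiable_comp.
rewrite diff_comp // /= diff_partial //; apply: eq_bigr => i _.
by rewrite mulrC diff_cV // mxE /partial -deriveE.
Qed.

Lemma open_near U x (P : 'cV[R]_n -> Prop) :
  open U -> U x -> (forall y, U y -> P y) -> \forall y \near x, P y.
Proof. by move=> oU Ux UP; apply: filterS UP _; exact: open_nbhs_nbhs. Qed.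

(** Openness of [U] turns equality on [U] into equality near each of its points; this passes to the
    partial derivatives and feeds the induction. *)
Lemma Ck_eq k U f g : open U -> (forall x, U x -> f x = g x) ->
  Ck k U f -> Ck k U g.
Proof.
move=> oU; elim: k f g => [|k IH] f g fg /=.
  move=> cf x Ux; have fgx := open_near oU Ux fg.
  rewrite /prop_for /continuous_at -(fg _ Ux); apply: cvg_trans (cf x Ux).
  exact: (near_eq_cvg (F := nbhs x) fgx).
case=> df cf; split=> [x Ux|i].
  exact: near_eq_differentiable (open_near oU Ux fg) (df x Ux).
by apply: IH (cf i) => x Ux; apply: partial_near_eq; exact: open_near Ux fg.
Qed.

Lemma CkS k U f : Ck k.+1 U f -> Ck k U f.
Proof.
elim: k f => [|k IH] f; first by case=> df _ x /df /differentiable_continuous.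
by case=> df cf; split=> // i; apply: IH (cf i).
Qed.

Lemma Ck_cst k U (c : R) : Ck k U (fun=> c).
Proof.
elim: k c => [|k IH] c /=; first by move=> x _; exact: cst_continuous.
split=> [x _|i]; first exact: differentiable_cst.
by rewrite (_ : partial i _ = fun=> 0) //; apply/funext => x; exact: partial_cst.
Qed.

Lemma CkD k U f g : open U -> Ck k U f -> Ck k U g ->
  Ck k U (fun x => f x + g x).
Proof.
move=> oU; elim: k f g => [|k IH] f g /=.
  by move=> cf cg x Ux; apply: continuousD; [exact: cf|exact: cg].
case=> df cf [dg cg]; split=> [x Ux|i].
  by apply: differentiableD; [exact: df|exact: dg].
apply: Ck_eq (IH _ _ (cf i) (cg i)) => // x Ux.
by rewrite partialD //; [exact: df|exact: dg].
Qed.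

Lemma CkM k U f g : open U -> Ck k U f -> Ck k U g ->
  Ck k U (fun x => f x * g x).
Proof.
move=> oU; elim: k f g => [|k IH] f g.
  by move=> cf cg x Ux; apply: continuousM; [exact: cf|exact: cg].
move=> Cf Cg; have [df cf] := Cf; have [dg cg] := Cg; split=> [x Ux|i].
  by apply: differentiableM; [exact: df|exact: dg].
(* Each Leibniz term keeps one factor undifferentiated; [CkS] lowers that factor to level [k]. *)
apply: Ck_eq (CkD oU (IH _ _ (CkS Cf) (cg i)) (IH _ _ (CkS Cg) (cf i))) => // x Ux.
by rewrite partialM //; [exact: df|exact: dg].
Qed.

Lemma CkV k U f : open U -> (forall x, U x -> f x != 0) -> Ck k U f ->
  Ck k U (fun x => (f x)^-1).
Proof.
move=> oU f0; elim: k => [|k IH].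
  by move=> cf x Ux; apply: continuousV; [exact: f0|exact: cf].
move=> Cf; have [df cf] := Cf; split=> [x Ux|i].
  by apply: differentiableV; [exact: df|exact: f0].
have CV := IH (CkS Cf).
(* The derivative [- f^-2 * partial i f], written as a product of functions already known to satisfy
   [Ck k U]. *)
apply: Ck_eq (CkM oU (CkM oU (Ck_cst k U (-1)) (CkM oU CV CV)) (cf i)) => // x Ux.
by rewrite partialV ?f0 //; [rewrite -exprVn mulN1r expr2|exact: df].
Qed.

Lemma smooth_differentiable U f x : smooth U f -> U x -> differentiable f x.
Proof. by move=> /(_ 1%N) [df _]; exact: df. Qed.

Lemma smooth_partial U f i : smooth U f -> smooth U (partial i f).
Proof. by move=> sf k; have [_] := sf k.+1; apply. Qed.

Lemma smooth_eq U f g : open U -> (forall x, U x -> f x = g x) ->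
  smooth U f -> smooth U g.
Proof. by move=> oU fg sf k; exact: Ck_eq (sf k). Qed.

Lemma smooth_cst U (c : R) : smooth U (fun=> c).
Proof. by move=> k; exact: Ck_cst. Qed.

Lemma smoothD U f g : open U -> smooth U f -> smooth U g ->
  smooth U (fun x => f x + g x).
Proof. by move=> oU sf sg k; exact: CkD. Qed.

Lemma smoothM U f g : open U -> smooth U f -> smooth U g ->
  smooth U (fun x => f x * g x).
Proof. by move=> oU sf sg k; exact: CkM. Qed.

Lemma smoothN U f : open U -> smooth U f -> smooth U (fun x => - f x).
Proof.
move=> oU sf; apply: smooth_eq (smoothM oU (smooth_cst U (-1)) sf) => // x _.
by rewrite mulN1r.
Qed.

Lemma smoothV U f : open U -> (forall x, U x -> f x != 0) -> smooth U f ->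
  smooth U (fun x => (f x)^-1).
Proof. by move=> oU f0 sf k; exact: CkV. Qed.

Lemma smooth_sum U (T : Type) (r : seq T) (P : pred T) (F : T -> 'cV[R]_n -> R) :
  open U -> (forall t, smooth U (F t)) -> smooth U (fun x => \sum_(t <- r | P t) F t x).
Proof.
move=> oU sF; elim: r => [|t r IH].
  by apply: smooth_eq (smooth_cst U 0) => // x _; rewrite big_nil.
case Pt: (P t).
  by apply: smooth_eq (smoothD oU (sF t) IH) => // x _; rewrite big_cons Pt.
by apply: smooth_eq IH => // x _; rewrite big_cons Pt.
Qed.

Lemma smooth_prod U (T : Type) (r : seq T) (P : pred T) (F : T -> 'cV[R]_n -> R) :
  open U -> (forall t, smooth U (F t)) -> smooth U (fun x => \prod_(t <- r | P t) F t x).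
Proof.
move=> oU sF; elim: r => [|t r IH].
  by apply: smooth_eq (smooth_cst U 1) => // x _; rewrite big_nil.
case Pt: (P t).
  by apply: smooth_eq (smoothM oU (sF t) IH) => // x _; rewrite big_cons Pt.
by apply: smooth_eq IH => // x _; rewrite big_cons Pt.
Qed.

End RealCalculus.

(** * Symmetry of second partial derivatives *)

Section Schwarz.
Context {R : realType} {n : nat}.
Implicit Types (U : set 'cV[R]_n) (f g : 'cV[R]_n -> R) (x p v w : 'cV[R]_n).

(** The difference quotients of the restriction to the line are literally those of [f] in the
    direction [v]. *)
Lemma is_derive_line f p v (s : R) : differentiable f (p + s *: v) ->
  is_derive s 1 (fun t => f (p + t *: v)) ('D_v f (p + s *: v)).
Proof.
move=> df; have H : (fun h : R => h^-1 *: ((fun t => f (p + t *: v)) (h *: 1 + s)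
     - f (p + s *: v))) = (fun h => h^-1 *: (f (h *: v + (p + s *: v)) - f (p + s *: v))).
  apply/funext => h; congr (_ *: (f _ - _)).
  by rewrite scaler1 scalerDl addrCA.
apply: DeriveDef; last by rewrite /derive H.
by rewrite /derivable H; exact: diff_derivable.
Qed.

Lemma mvt_line f p v (h : R) : 0 < h ->
  (forall s, 0 <= s <= h -> differentiable f (p + s *: v)) ->
  exists2 s, 0 <= s <= h & f (p + h *: v) - f p = h * 'D_v f (p + s *: v).
Proof.
move=> h0 df; have dl s : 0 <= s <= h -> is_derive s 1 (fun t => f (p + t *: v)) ('D_v f (p + s *: v)).
  by move=> sh; apply: is_derive_line; exact: df.
have [||s] := @MVT R (fun t => f (p + t *: v)) (fun s => 'D_v f (p + s *: v)) 0 h h0.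
- by move=> s; rewrite in_itv /= => /andP[s0 sh]; apply: dl; rewrite !ltW.
- apply: derivable_within_continuous => s; rewrite in_itv /= => sh.
  by have [] := dl s sh.
rewrite in_itv /= scale0r addr0 subr0 => /andP[s0 sh] ->.
by exists s; rewrite ?ltW // mulrC.
Qed.

Lemma derive_translate f v w x : 'D_v (fun y => f (y + w)) x = 'D_v f (x + w).
Proof.
have E : (fun h : R => h^-1 *: (((fun y => f (y + w)) \o shift x) (h *: v) - f (x + w)))
       = (fun h => h^-1 *: ((f \o shift (x + w)) (h *: v) - f (x + w))).
  by apply/funext => h /=; rewrite addrA.
by rewrite /derive E.
Qed.

(* Two applications of the mean value theorem, first along e_i, then along e_j. *)
Lemma second_difference U f p i j (h : R) : smooth U f -> 0 < h ->
  (forall s t : R, 0 <= s <= h -> 0 <= t <= h ->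
    U (p + s *: delta_mx i 0 + t *: delta_mx j 0)) ->
  exists s t, [/\ 0 <= s <= h, 0 <= t <= h &
    f (p + h *: delta_mx i 0 + h *: delta_mx j 0) - f (p + h *: delta_mx i 0)
      - (f (p + h *: delta_mx j 0) - f p)
    = h * (h * partial j (partial i f) (p + s *: delta_mx i 0 + t *: delta_mx j 0))].
Proof.
move=> sf h0 Uh.
set v := delta_mx i 0 in Uh *; set w := delta_mx j 0 in Uh *.
have hh : 0 <= h <= h by rewrite ltW /=.
have h00 : 0 <= (0 : R) <= h by rewrite lexx ltW.
(* The second difference of [f] is the increment of [g] from [p] to [p + h *: v]. *)
pose g y := f (y + h *: w) - f y.
have Us s : 0 <= s <= h -> U (p + s *: v).
  by move=> sh; rewrite -[_ + _]addr0 -(scale0r w); exact: Uh.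
have df1 s : 0 <= s <= h ->
    differentiable (fun y => f (y + h *: w)) (p + s *: v).
  move=> sh; apply: (@differentiable_comp _ _ _ _ (fun z : 'cV[R]_n => z + h *: w) f).
    exact: differentiableD.
  by apply: (smooth_differentiable sf); exact: Uh.
have df2 s : 0 <= s <= h -> differentiable f (p + s *: v).
  by move=> sh; apply: (smooth_differentiable sf); exact: Us.
have dg s : 0 <= s <= h -> differentiable g (p + s *: v).
  by move=> sh; apply: differentiableB; [exact: df1|exact: df2].
have [s sh gE] := mvt_line h0 dg.
have dDf t : 0 <= t <= h -> differentiable (partial i f) (p + s *: v + t *: w).
  by move=> th; apply: (smooth_differentiable (smooth_partial i sf)); exact: Uh.
have [t th DE] := mvt_line h0 dDf.
exists s, t; split => //; rewrite -DE.
(* Differentiating [g] along [v] gives the increment of [partial i f] along [w], which [DE]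
   evaluates. *)
have -> : partial i f (p + s *: v + h *: w) - partial i f (p + s *: v) = 'D_v g (p + s *: v).
  rewrite /g deriveB; [|by apply: diff_derivable; exact: df1
                       |by apply: diff_derivable; exact: df2].
  by rewrite derive_translate.
by rewrite -gE.
Qed.

(** Schwarz's theorem. The second difference over a small parallelogram is symmetric in the two
    directions and equals [h * h] times a value of either mixed derivative. If these continuous
    derivatives differed at [x], their values near [x] could not agree. *)
Lemma partial_comm U f x i j : open U -> smooth U f -> U x ->
  partial i (partial j f) x = partial j (partial i f) x.
Proof.
move=> oU sf Ux; set a := partial i (partial j f); set b := partial j (partial i f).
have cont_smooth c : smooth U c -> {for x, continuous c}.
  by move=> /smooth_differentiable/(_ Ux)/differentiable_continuous.
have ca : {for x, continuous a} by apply: cont_smooth; do 2 apply: smooth_partial.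
have cb : {for x, continuous b} by apply: cont_smooth; do 2 apply: smooth_partial.
apply: contrapT => /eqP ab.
(* Half the gap: a number cannot be at distance less than [e] from both [a x] and [b x]. *)
have e0 : 0 < `|a x - b x| / 2 by rewrite divr_gt0 // normr_gt0 subr_eq0.
set e := _ / 2 in e0.
have /nbhs_ballP[r /= r0 rP] : \forall y \near x,
    [/\ U y, `|a x - a y| < e & `|b x - b y| < e].
  have nU : nbhs x U by exact: open_nbhs_nbhs.
  have na : \forall y \near x, `|a x - a y| < e by move/cvgrPdist_lt : ca; apply.
  have nb : \forall y \near x, `|b x - b y| < e by move/cvgrPdist_lt : cb; apply.
  by apply: filterS3 nU na nb => y Uy ay By.
(* For [h = r / N], every displacement in the parallelogram has norm at most [h * (N - 1)], which is
   less than [r]; the summand 1 makes this strict and keeps [N] positive. *)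
pose N : R := `|delta_mx i 0 : 'cV[R]_n| + `|delta_mx j 0 : 'cV[R]_n| + 1.
have N0 : 0 < N by rewrite ltr_pwDr // addr_ge0.
pose h := r / N; have h0 : 0 < h by rewrite divr_gt0.
have inball k l (s t : R) : `|delta_mx k 0 : 'cV[R]_n| + `|delta_mx l 0 : 'cV[R]_n| + 1 = N ->
    0 <= s <= h -> 0 <= t <= h ->
    ball x r (x + s *: delta_mx k 0 + t *: delta_mx l 0).
  move=> NE /andP[s0 sh] /andP[t0 th].
  rewrite -ball_normE /ball_ /= -addrA opprD addrA subrr add0r normrN.
  apply: le_lt_trans (ler_normD _ _) _; rewrite !normrZ !ger0_norm //.
  have -> : r = h * N by rewrite /h divfK ?gt_eqF.
  rewrite -NE !mulrDr mulr1 ltr_pwDr // lerD //; exact: ler_wpM2r.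
have NC : `|delta_mx j 0 : 'cV[R]_n| + `|delta_mx i 0 : 'cV[R]_n| + 1 = N.
  by congr (_ + 1); rewrite addrC.
have [|s [t [sh th E1]]] := @second_difference U f x i j h sf h0.
  by move=> s t sh th; have [] := rP _ (inball i j s t erefl sh th).
have [|s' [t' [sh' th' E2]]] := @second_difference U f x j i h sf h0.
  by move=> s' t' sh' th'; have [] := rP _ (inball j i s' t' NC sh' th').
have [_ _ Hb] := rP _ (inball i j s t erefl sh th).
have [_ Ha _] := rP _ (inball j i s' t' NC sh' th').
(* Both values come from the same second difference, read in the two orders, after cancelling [h]
   twice. *)
have E : b (x + s *: delta_mx i 0 + t *: delta_mx j 0)
     = a (x + s' *: delta_mx j 0 + t' *: delta_mx i 0).
  have hn0 : h != 0 by rewrite gt_eqF.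
  have hE : h * (h * b (x + s *: delta_mx i 0 + t *: delta_mx j 0))
      = h * (h * a (x + s' *: delta_mx j 0 + t' *: delta_mx i 0)).
    apply: etrans (esym E1) (etrans _ E2).
    rewrite [x + h *: delta_mx j 0 + _]addrAC.
    by rewrite !opprB addrACA [RHS]addrACA [- _ - _]addrC.
  exact: (mulfI hn0 (mulfI hn0 hE)).
rewrite E in Hb.
have := ler_normB (a x - a (x + s' *: delta_mx j 0 + t' *: delta_mx i 0))
  (b x - a (x + s' *: delta_mx j 0 + t' *: delta_mx i 0)).
rewrite opprB addrA subrK => le1.
have S : `|a x - b x| = e + e by rewrite /e -splitr.
by have := le_lt_trans le1 (ltrD Ha Hb); rewrite S ltxx.
Qed.

End Schwarz.

(** * Complex-valued functions *)

Section ComplexCalculus.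
Context {R : realType} {n : nat}.
Local Notation C := R[i].
Implicit Types (U : set 'cV[R]_n) (f g : 'cV[R]_n -> C) (x : 'cV[R]_n).

Definition diffC f x : Prop :=
  differentiable (fun y => complex.Re (f y)) x
  /\ differentiable (fun y => complex.Im (f y)) x.

(** Each entry condition of [smooth_mxC] is this one up to conversion, so the closure lemmas below
    apply to it entry by entry. *)
Definition smoothC U f : Prop :=
  smooth U (fun y => complex.Re (f y)) /\ smooth U (fun y => complex.Im (f y)).

Lemma eqC (a b : C) :
  complex.Re a = complex.Re b -> complex.Im a = complex.Im b -> a = b.
Proof. by case: a b => [? ?] [? ?] /= -> ->. Qed.

Lemma ReM (a b : C) : complex.Re (a * b)
  = complex.Re a * complex.Re b - complex.Im a * complex.Im b.
Proof. by case: a b => [? ?] [? ?]. Qed.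

Lemma ImM (a b : C) : complex.Im (a * b)
  = complex.Re a * complex.Im b + complex.Im a * complex.Re b.
Proof. by case: a b => [? ?] [? ?]. Qed.

Lemma ReD (a b : C) : complex.Re (a + b) = complex.Re a + complex.Re b.
Proof. by case: a b => [? ?] [? ?]. Qed.

Lemma ImD (a b : C) : complex.Im (a + b) = complex.Im a + complex.Im b.
Proof. by case: a b => [? ?] [? ?]. Qed.

Lemma diffC_cst (c : C) x : diffC (fun=> c) x.
Proof. by split; exact: differentiable_cst. Qed.

Lemma diffCD f g x : diffC f x -> diffC g x -> diffC (fun y => f y + g y) x.
Proof.
move=> [fr fi] [gr gi]; split.
  by under eq_fun do rewrite ReD; exact: differentiableD.
by under eq_fun do rewrite ImD; exact: differentiableD.
Qed.

Lemma diffCM f g x : diffC f x -> diffC g x -> diffC (fun y => f y * g y) x.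
Proof.
move=> [fr fi] [gr gi]; split.
  under eq_fun do rewrite ReM.
  by apply: differentiableB; exact: differentiableM.
under eq_fun do rewrite ImM.
by apply: differentiableD; exact: differentiableM.
Qed.

Lemma diffC_sum (T : Type) (r : seq T) (P : pred T) (F : T -> 'cV[R]_n -> C) x :
  (forall t, diffC (F t) x) -> diffC (fun y => \sum_(t <- r | P t) F t y) x.
Proof.
move=> dF; elim: r => [|t r IH].
  by under eq_fun do rewrite big_nil; exact: diffC_cst.
under eq_fun do rewrite big_cons.
by case: (P t) => //; exact: diffCD.
Qed.

Lemma diffC_real (f : 'cV[R]_n -> R) x :
  differentiable f x -> diffC (fun y => (f y)%:C%C) x.
Proof. by move=> df; split=> //=; exact: differentiable_cst. Qed.

Lemma diffC_near f g x :
  (\forall y \near x, f y = g y) -> diffC f x -> diffC g x.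
Proof.
move=> fg [dr di]; split.
  by apply: near_eq_differentiable dr; apply: filterS fg => y /= ->.
by apply: near_eq_differentiable di; apply: filterS fg => y /= ->.
Qed.

Lemma diffC_comp f (F : 'cV[R]_n -> 'cV[R]_n) x :
  (forall i, differentiable (fun y => F y i 0) x) ->
  diffC f (F x) -> diffC (fun y => f (F y)) x.
Proof.
by move=> dF [dr di]; split; [exact: (differentiable_comp_cV dF dr)|exact: (differentiable_comp_cV dF di)].
Qed.

Lemma partialC_near i f g x :
  (\forall y \near x, f y = g y) -> partialC i f x = partialC i g x.
Proof.
move=> fg; rewrite /partialC; congr Complex.
  by apply: partial_near_eq; apply: filterS fg => y /= ->.
by apply: partial_near_eq; apply: filterS fg => y /= ->.
Qed.

Lemma partialC_cst i (c : C) x : partialC i (fun=> c) x = 0.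
Proof. by rewrite /partialC !partial_cst. Qed.

Lemma partialCD i f g x : diffC f x -> diffC g x ->
  partialC i (fun y => f y + g y) x = partialC i f x + partialC i g x.
Proof.
move=> [fr fi] [gr gi]; apply: eqC; rewrite ?ReD ?ImD /=.
  by under eq_fun do rewrite ReD; rewrite partialD.
by under eq_fun do rewrite ImD; rewrite partialD.
Qed.

Lemma partialCM i f g x : diffC f x -> diffC g x ->
  partialC i (fun y => f y * g y) x = f x * partialC i g x + partialC i f x * g x.
Proof.
move=> [fr fi] [gr gi]; apply: eqC; rewrite ?ReD ?ImD ?ReM ?ImM /=.
  under eq_fun do rewrite ReM.
  rewrite partialD ?partialN ?partialM //; [ring|exact: differentiableM..|].
  by apply: differentiableN; exact: differentiableM.
under eq_fun do rewrite ImM.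
by rewrite partialD ?partialM //; [ring|exact: differentiableM..].
Qed.

Lemma partialCZ i (c : C) f x : diffC f x ->
  partialC i (fun y => c * f y) x = c * partialC i f x.
Proof.
by move=> df; rewrite partialCM ?partialC_cst ?mul0r ?addr0 //; exact: diffC_cst.
Qed.

Lemma partialC_sum i (T : Type) (r : seq T) (P : pred T)
    (F : T -> 'cV[R]_n -> C) x : (forall t, diffC (F t) x) ->
  partialC i (fun y => \sum_(t <- r | P t) F t y) x
  = \sum_(t <- r | P t) partialC i (F t) x.
Proof.
move=> dF; elim: r => [|t r IH].
  by under eq_fun do rewrite big_nil; rewrite partialC_cst big_nil.
under eq_fun do rewrite big_cons; rewrite big_cons.
by case: (P t) => //; rewrite partialCD ?IH //; exact: diffC_sum.
Qed.

Lemma partialC_real i (f : 'cV[R]_n -> R) x :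
  partialC i (fun y => (f y)%:C%C) x = (partial i f x)%:C%C.
Proof. by rewrite /partialC /= partial_cst. Qed.

Lemma partialC_comp j f (F : 'cV[R]_n -> 'cV[R]_n) x :
  (forall i, differentiable (fun y => F y i 0) x) -> diffC f (F x) ->
  partialC j (fun y => f (F y)) x
  = \sum_i partialC i f (F x) * (jac F x i j)%:C%C.
Proof.
move=> dF [dr di].
(* The Jacobian entries are real, so real and imaginary parts separate and the real chain rule
   applies to each. *)
have sumE (r : seq 'I_n) (P : 'I_n -> C) (A : 'I_n -> R) :
    \sum_(i <- r) P i * (A i)%:C%C
    = ((\sum_(i <- r) complex.Re (P i) * A i) +i* (\sum_(i <- r) complex.Im (P i) * A i))%C.
  elim: r => [|i r IH]; first by rewrite !big_nil.
  rewrite !big_cons IH; case: (P i) => a b /=.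
  by apply: eqC; rewrite /= ?mulr0 ?subr0 ?add0r.
by rewrite sumE /partialC /= -(partial_comp _ dF dr) -(partial_comp _ dF di).
Qed.

Lemma smoothC_diff U f x : smoothC U f -> U x -> diffC f x.
Proof.
by move=> [sr si] Ux; split; [exact: (smooth_differentiable sr)|exact: (smooth_differentiable si)].
Qed.

Lemma smoothC_cst U (c : C) : smoothC U (fun=> c).
Proof. by split; exact: smooth_cst. Qed.

Lemma smoothCD U f g : open U -> smoothC U f -> smoothC U g ->
  smoothC U (fun y => f y + g y).
Proof.
move=> oU [fr fi] [gr gi]; split.
  by under eq_fun do rewrite ReD; exact: smoothD.
by under eq_fun do rewrite ImD; exact: smoothD.
Qed.

Lemma smoothCM U f g : open U -> smoothC U f -> smoothC U g ->
  smoothC U (fun y => f y * g y).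
Proof.
move=> oU [fr fi] [gr gi]; split.
  under eq_fun do rewrite ReM.
  by apply: smoothD => //; [|apply: smoothN => //]; exact: smoothM.
under eq_fun do rewrite ImM.
by apply: smoothD => //; exact: smoothM.
Qed.

Lemma smoothCN U f : open U -> smoothC U f -> smoothC U (fun y => - f y).
Proof.
by move=> oU sf; under eq_fun do rewrite -mulN1r; apply: smoothCM => //; exact: smoothC_cst.
Qed.

Lemma smoothC_sum U (T : Type) (r : seq T) (P : pred T) (F : T -> 'cV[R]_n -> C) :
  open U -> (forall t, smoothC U (F t)) ->
  smoothC U (fun y => \sum_(t <- r | P t) F t y).
Proof.
move=> oU sF; elim: r => [|t r IH].
  by under eq_fun do rewrite big_nil; exact: smoothC_cst.
under eq_fun do rewrite big_cons.
by case: (P t) => //; exact: smoothCD.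
Qed.

Lemma smoothC_partial U f i : smoothC U f -> smoothC U (partialC i f).
Proof. by move=> [sr si]; split; apply: smooth_partial. Qed.

End ComplexCalculus.

(** * The Courant bracket in coordinates *)

Section CourantCalculus.
Context {R : realType} {n : nat}.
Local Notation C := R[i].
Local Notation contraction := Defs.contraction.
Implicit Types (x : 'cV[R]_n) (X Y Z W xi eta : 'cV[R]_n -> 'cV[C]_n).
Implicit Types (B : 'cV[R]_n -> 'M[C]_n).

Definition diffCmx p q (F : 'cV[R]_n -> 'M[C]_(p, q)) x : Prop :=
  forall i j, diffC (fun y => F y i j) x.

Definition jacC X x : 'M[C]_n := \matrix_(i, j) partialC j (fun y => X y i 0) x.

(* The matrix of v |-> (D_v B) u, for a fixed vector u. *)
Definition dmx B (u : 'cV[C]_n) x : 'M[C]_n :=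
  \matrix_(i, j) \sum_s partialC j (fun y => B y i s) x * u s 0.

Lemma diffCmx_mulmx p q r (F : 'cV[R]_n -> 'M[C]_(p, q)) (G : 'cV[R]_n -> 'M[C]_(q, r)) x :
  diffCmx F x -> diffCmx G x -> diffCmx (fun y => F y *m G y) x.
Proof.
move=> dF dG i j; under eq_fun do rewrite mxE.
by apply: diffC_sum => k; exact: diffCM.
Qed.

Lemma diffCmx_tr p q (F : 'cV[R]_n -> 'M[C]_(p, q)) x :
  diffCmx F x -> diffCmx (fun y => (F y)^T) x.
Proof. by move=> dF i j; under eq_fun do rewrite mxE; exact: dF. Qed.

Lemma diffCmx_near p q (F G : 'cV[R]_n -> 'M[C]_(p, q)) x :
  (\forall y \near x, F y = G y) -> diffCmx F x -> diffCmx G x.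
Proof. by move=> FG dF i j; apply: diffC_near (dF i j); apply: filterS FG => y /= ->. Qed.

Lemma jacC_near X Y x : (\forall y \near x, X y = Y y) -> jacC X x = jacC Y x.
Proof.
move=> XY; apply/matrixP => i j; rewrite !mxE; apply: partialC_near.
by apply: filterS XY => y /= ->.
Qed.

(** Leibniz's rule; [dmx] collects the terms in which [B] is differentiated. *)
Lemma jacC_mul B X x : diffCmx B x -> diffCmx X x ->
  jacC (fun y => B y *m X y) x = B x *m jacC X x + dmx B (X x) x.
Proof.
move=> dB dX; apply/matrixP => i j; rewrite !mxE -big_split /=.
under eq_fun do rewrite mxE.
rewrite partialC_sum; last by move=> t; exact: diffCM.
by apply: eq_bigr => s _; rewrite partialCM // mxE.
Qed.

Lemma jacC0 x : jacC (fun=> 0) x = 0.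
Proof.
apply/matrixP => i j; rewrite !mxE -[RHS](partialC_cst j 0 x).
by congr (partialC j _ x); apply/funext => y; rewrite mxE.
Qed.

Lemma jacC_comp X (F : 'cV[R]_n -> 'cV[R]_n) x :
  (forall i, differentiable (fun y => F y i 0) x) -> diffCmx X (F x) ->
  jacC (fun y => X (F y)) x = jacC X (F x) *m complexify (jac F x).
Proof.
move=> dF dX; apply/matrixP => i j; rewrite !mxE.
rewrite (@partialC_comp _ _ j (fun y => X y i 0)) //.
by apply: eq_bigr => k _; rewrite !mxE.
Qed.

(** With the matrix forms of the bracket and of the Lie derivative, the later computations become
    noncommutative matrix algebra instead of index sums. *)
Lemma lie_bracketE X Y x : lie_bracket X Y x = jacC Y x *m X x - jacC X x *m Y x.
Proof.
apply/matrixP => i j; rewrite ord1 !mxE -sumrB.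
by apply: eq_bigr => k _; rewrite !mxE; congr (_ - _); exact: mulrC.
Qed.

Lemma lie_deriv_formE X eta x :
  lie_deriv_form X eta x = jacC eta x *m X x + (jacC X x)^T *m eta x.
Proof.
apply/matrixP => i j; rewrite ord1 !mxE -big_split /=.
by apply: eq_bigr => k _; rewrite !mxE; congr (_ + _); exact: mulrC.
Qed.

Lemma contractionE X eta x : contraction X eta x = ((eta x)^T *m X x) 0 0.
Proof. by rewrite mxE; apply: eq_bigr => k _; rewrite mxE. Qed.

Lemma contractionEr X eta x : contraction X eta x = ((X x)^T *m eta x) 0 0.
Proof. by rewrite mxE; apply: eq_bigr => k _; rewrite mxE mulrC. Qed.

Lemma diffC_contraction X eta x : diffCmx X x -> diffCmx eta x ->
  diffC (contraction X eta) x.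
Proof. by move=> dX deta; apply: diffC_sum => k; exact: diffCM. Qed.

Lemma ext_diff_near (f g : 'cV[R]_n -> C) x :
  (\forall y \near x, f y = g y) -> ext_diff f x = ext_diff g x.
Proof. by move=> fg; apply/matrixP => i j; rewrite !mxE; exact: partialC_near. Qed.

Lemma ext_diffZ (c : C) (f : 'cV[R]_n -> C) x : diffC f x ->
  ext_diff (fun y => c * f y) x = c *: ext_diff f x.
Proof. by move=> df; apply/matrixP => i j; rewrite !mxE; exact: partialCZ. Qed.

Lemma ext_diff_comp (f : 'cV[R]_n -> C) (F : 'cV[R]_n -> 'cV[R]_n) x :
  (forall i, differentiable (fun y => F y i 0) x) -> diffC f (F x) ->
  ext_diff (fun y => f (F y)) x = (complexify (jac F x))^T *m ext_diff f (F x).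
Proof.
move=> dF df; apply/matrixP => i j; rewrite !mxE partialC_comp //.
by apply: eq_bigr => k _; rewrite !mxE mulrC.
Qed.

Lemma ext_diff_contraction X eta x : diffCmx X x -> diffCmx eta x ->
  ext_diff (contraction X eta) x = (jacC eta x)^T *m X x + (jacC X x)^T *m eta x.
Proof.
move=> dX deta; apply/matrixP => i j; rewrite !mxE ord1 -big_split /=.
rewrite partialC_sum; last by move=> t; exact: diffCM.
by apply: eq_bigr => k _; rewrite !mxE partialCM // addrC; congr (_ + _); rewrite mulrC.
Qed.

(** * Naturality of the bracket operations under a change of coordinates *)

Section ChangeOfCoordinates.
Variables (U : set 'cV[R]_n) (F : 'cV[R]_n -> 'cV[R]_n) (x : 'cV[R]_n).
Hypotheses (oU : open U) (Ux : U x) (sF : smooth_mx U F).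
Local Notation A y := (complexify (jac F y)).

Lemma partialC_jac k i s : partialC k (fun y => A y i s) x
  = (partial k (partial s (fun y => F y i 0)) x)%:C%C.
Proof.
rewrite -partialC_real; congr (partialC k _ x).
by apply/funext => y; rewrite !mxE.
Qed.

Lemma smooth_mx_coord i : differentiable (fun y => F y i 0) x.
Proof. exact: (smooth_differentiable (sF i 0)). Qed.

Lemma diffCmx_jac : diffCmx (fun y => A y) x.
Proof.
move=> i j; under eq_fun do rewrite !mxE; apply: diffC_real.
by apply: (smooth_differentiable (U := U)) => //; apply: smooth_partial; exact: sF.
Qed.

(** Both sides are the second derivative of [F] evaluated on [u] and [v], so [partial_comm]
    applies. *)
Lemma dmx_jac_sym u v : dmx (fun y => A y) u x *m v = dmx (fun y => A y) v x *m u.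
Proof.
apply/matrixP => i j; rewrite !mxE.
under eq_bigr do rewrite mxE mulr_suml.
under [RHS]eq_bigr do rewrite mxE mulr_suml.
rewrite exchange_big /=; apply: eq_bigr => k _; apply: eq_bigr => l _.
rewrite !partialC_jac (partial_comm _ _ oU (sF i 0) Ux) !ord1; ring.
Qed.

(** Component [i] of either side contracts the second derivatives of [F] in the directions [i] and
    [v] with the covector [u]; only the order of differentiation differs. *)
Lemma dmx_jac_tr u v :
  dmx (fun y => (A y)^T) u x *m v = (dmx (fun y => A y) v x)^T *m u.
Proof.
apply/matrixP => i j; rewrite !mxE.
under eq_bigr do rewrite mxE mulr_suml.
under [RHS]eq_bigr do rewrite !mxE mulr_suml.
rewrite exchange_big /=; apply: eq_bigr => k _; apply: eq_bigr => l _.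
under eq_fun do rewrite mxE.
rewrite !partialC_jac (partial_comm _ _ oU (sF _ 0) Ux) !ord1; ring.
Qed.

Lemma lie_bracket_change X Y X' Y' :
  (forall y, U y -> X' (F y) = A y *m X y) ->
  (forall y, U y -> Y' (F y) = A y *m Y y) ->
  diffCmx X x -> diffCmx Y x -> diffCmx X' (F x) -> diffCmx Y' (F x) ->
  lie_bracket X' Y' (F x) = A x *m lie_bracket X Y x.
Proof.
move=> XX YY dX dY dX' dY'.
(* Differentiating the transformation law of a vector field leaves a second-derivative term in [F];
   in the bracket the two such terms cancel by [dmx_jac_sym]. *)
have key Z Z' : (forall y, U y -> Z' (F y) = A y *m Z y) ->
    diffCmx Z x -> diffCmx Z' (F x) ->
    jacC Z' (F x) *m A x = A x *m jacC Z x + dmx (fun y => A y) (Z x) x.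
  move=> ZZ dZ dZ'; rewrite -jacC_comp //; last exact: smooth_mx_coord.
  rewrite -jacC_mul //; last exact: diffCmx_jac.
  by apply: jacC_near; exact: open_near Ux ZZ.
rewrite !lie_bracketE XX // YY // !mulmxA (key X X') // (key Y Y') // !mulmxDl -!mulmxA.
rewrite (dmx_jac_sym (Y x)) opprD addrACA subrr addr0 -mulmxBr //.
Qed.

(** The laws for [X] and for [eta] each contribute a second-derivative term, one on either side of
    the equation; [dmx_jac_tr] identifies them. *)
Lemma lie_deriv_form_change X X' eta eta' :
  (forall y, U y -> X' (F y) = A y *m X y) ->
  (forall y, U y -> eta y = (A y)^T *m eta' (F y)) ->
  diffCmx X x -> diffCmx X' (F x) -> diffCmx eta' (F x) ->
  lie_deriv_form X eta x = (A x)^T *m lie_deriv_form X' eta' (F x).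
Proof.
move=> XX ee dX dX' deta'.
have dF := smooth_mx_coord; have dA := diffCmx_jac.
have keyX : jacC X' (F x) *m A x = A x *m jacC X x + dmx (fun y => A y) (X x) x.
  rewrite -jacC_comp // -jacC_mul //.
  by apply: jacC_near; exact: open_near Ux XX.
have keye : jacC eta x = (A x)^T *m (jacC eta' (F x) *m A x)
                         + dmx (fun y => (A y)^T) (eta' (F x)) x.
  rewrite -jacC_comp // -(@jacC_mul (fun y => (A y)^T) (fun y => eta' (F y))).
  - by apply: jacC_near; exact: open_near Ux ee.
  - exact: diffCmx_tr.
  - by move=> i j; exact: (@diffC_comp _ _ (fun y => eta' y i j)).
rewrite !lie_deriv_formE keye ee // XX // mulmxDl -!mulmxA dmx_jac_tr.
rewrite [RHS]mulmxDr -addrA; congr (_ + _).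
rewrite [RHS]mulmxA -[(A x)^T *m (jacC X' _)^T]trmx_mul keyX linearD /= mulmxDl.
by rewrite trmx_mul mulmxA addrC.
Qed.

Lemma contraction_change X X' eta eta' y : U y ->
  X' (F y) = A y *m X y -> eta y = (A y)^T *m eta' (F y) ->
  contraction X eta y = contraction X' eta' (F y).
Proof. by move=> Uy XX ee; rewrite !contractionE XX ee trmx_mul trmxK mulmxA. Qed.

End ChangeOfCoordinates.
End CourantCalculus.

Section CourantForm.
Context {R : realType} {n : nat}.
Local Notation C := R[i].
Local Notation contraction := Defs.contraction.
Implicit Types (X Y xi eta : 'cV[R]_n -> 'cV[C]_n).

(** The covector component of [courant], with vector and covector parts as separate arguments so
    that they can be varied independently. *)
Definition courant_form X xi Y eta : 'cV[R]_n -> 'cV[C]_n := fun x =>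
  lie_deriv_form X eta x - lie_deriv_form Y xi x
    - 2^-1 *: ext_diff (fun y => contraction X eta y - contraction Y xi y) x.

Lemma lie_deriv_form_near X eta xi x : (\forall y \near x, eta y = xi y) ->
  lie_deriv_form X eta x = lie_deriv_form X xi x.
Proof.
by move=> e; rewrite !lie_deriv_formE (jacC_near e) (nbhs_singleton e).
Qed.

End CourantForm.

(** * Cartan calculus for a closed complex 2-form *)

Section ClosedForms.
Context {R : realType} {n : nat}.
Local Notation C := R[i].
Local Notation contraction := Defs.contraction.
Variables (Om : 'cV[R]_n -> 'M[C]_n) (x : 'cV[R]_n).
Implicit Types (X Y Z W xi eta : 'cV[R]_n -> 'cV[C]_n).
Hypothesis dOm : diffCmx Om x.
Hypothesis OmT : \forall y \near x, (Om y)^T = - Om y.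
Hypothesis closedOm : forall a b c : 'I_n,
  partialC a (fun y => Om y c b) x + partialC b (fun y => Om y a c) x
  + partialC c (fun y => Om y b a) x = 0.

(** The identity [d Om = 0] contracted with [u] and [v], after one pair of indices is swapped by
    skewness. *)
Lemma dmx_closed u v :
  dmx Om u x *m v = dmx Om v x *m u - (dmx Om v x)^T *m u.
Proof.
(* Differentiating the relation requires skewness on a neighbourhood of [x], not just at [x]. *)
have antisym a b c : partialC a (fun y => Om y b c) x = - partialC a (fun y => Om y c b) x.
  rewrite -mulN1r -partialCZ //; apply: partialC_near.
  by apply: filterS OmT => y /matrixP /(_ c b); rewrite !mxE mulN1r.
apply/matrixP => i j; rewrite !mxE !ord1 -sumrB.
under eq_bigr do rewrite mxE mulr_suml.
under [RHS]eq_bigr do rewrite !mxE !mulr_suml -sumrB.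
rewrite exchange_big /=; apply: eq_bigr => k _; apply: eq_bigr => l _.
apply/eqP; rewrite -subr_eq0; apply/eqP.
transitivity ((partialC l (fun y => Om y i k) x - partialC k (fun y => Om y i l) x
  + partialC i (fun y => Om y k l) x) * (u k 0 * v l 0)); first by ring.
by rewrite (antisym k i l) opprK closedOm mul0r.
Qed.

(* Cartan's formula: L_X i_W Om = i_[X,W] Om + i_W L_X Om and, Om being closed,
   L_X Om = d (i_X Om). *)
Lemma lie_deriv_form_interior X W : diffCmx X x -> diffCmx W x ->
  let mu y := Om y *m X y in
  lie_deriv_form X (fun y => Om y *m W y) x
  = Om x *m lie_bracket X W x + (jacC mu x - (jacC mu x)^T) *m W x.
Proof.
move=> dX dW mu; have OmTx := nbhs_singleton OmT.
rewrite lie_deriv_formE lie_bracketE !jacC_mul // [(_ + _)^T]linearD /= trmx_mul OmTx.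
rewrite mulmxDl (dmx_closed (W x) (X x)) mulmxBr !mulmxA.
rewrite mulmxBl !mulmxDl mulmxN mulNmx.
move: (_ *m _ *m X x) (Om x *m jacC X x *m W x) (dmx _ _ _ *m _) (_^T *m W x) => a b c d.
move: (_ *m Om x *m _) => e.
by apply/matrixP => k l; rewrite !mxE; ring.
Qed.

(** Skewness gives [eta(X) = - xi(Y)], so the exact term of the bracket is [+ d(xi(Y))]. Since
    [L_Y xi = d(xi(Y)) + i_Y d xi], there remains [L_X eta - i_Y d xi], which is [Om [X,Y]] by
    [lie_deriv_form_interior]. *)
Lemma courant_form_graph X Y xi eta : diffCmx X x -> diffCmx Y x ->
  (\forall y \near x, xi y = Om y *m X y) ->
  (\forall y \near x, eta y = Om y *m Y y) ->
  courant_form X xi Y eta x = Om x *m lie_bracket X Y x.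
Proof.
move=> dX dY xiE etaE.
have dxi : diffCmx xi x.
  apply: diffCmx_near (diffCmx_mulmx dOm dX).
  by apply: filterS xiE => y ->.
have pE : \forall y \near x, - 2 * contraction Y xi y = contraction X eta y - contraction Y xi y.
  apply: filterS3 OmT xiE etaE => y OT xy ey.
  have -> : contraction X eta y = - contraction Y xi y.
    by rewrite contractionE contractionEr xy ey trmx_mul OT mulmxN mulNmx mulmxA mxE.
  by ring.
rewrite /courant_form -(ext_diff_near pE) ext_diffZ; last exact: diffC_contraction.
rewrite scalerA mulrN mulVf ?pnatr_eq0 // scaleN1r opprK ext_diff_contraction //.
rewrite (lie_deriv_form_near _ etaE) lie_deriv_form_interior //.
rewrite -(jacC_near xiE) lie_deriv_formE mulmxBl.
move: (Om x *m _) (jacC xi x *m _) ((jacC xi x)^T *m _) (_ *m xi x) => a b c d.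
by apply/matrixP => k l; rewrite !mxE; ring.
Qed.

(** For [X] in the kernel, Cartan's formula loses its [d(i_X Om)] term, and both pairings in the
    exact term vanish because [Om] is skew. *)
Lemma courant_form_kernel X Y Z W xi eta :
  diffCmx X x -> diffCmx Y x -> diffCmx Z x -> diffCmx W x ->
  (\forall y \near x, Om y *m X y = 0) ->
  (\forall y \near x, Om y *m Y y = 0) ->
  (\forall y \near x, xi y = Om y *m Z y) ->
  (\forall y \near x, eta y = Om y *m W y) ->
  Om x *m lie_bracket X Y x = 0
  /\ courant_form X xi Y eta x = Om x *m (lie_bracket X W x - lie_bracket Y Z x).
Proof.
move=> dX dY dZ dW X0 Y0 xiE etaE.
have cart X' W' : diffCmx X' x -> diffCmx W' x -> (\forall y \near x, Om y *m X' y = 0) ->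
    lie_deriv_form X' (fun y => Om y *m W' y) x = Om x *m lie_bracket X' W' x.
  move=> dX' dW' X'0; rewrite lie_deriv_form_interior // (jacC_near X'0) jacC0.
  by rewrite linear0 subr0 mul0mx addr0.
split.
  (* [Om [X,Y]] is the Lie derivative along [X] of the form [Om Y], which vanishes near [x]. *)
  rewrite -cart // (lie_deriv_form_near _ Y0) lie_deriv_formE jacC0.
  by rewrite mul0mx mulmx0 addr0.
have c0 X' W' zeta : (\forall y \near x, Om y *m X' y = 0) ->
    (\forall y \near x, zeta y = Om y *m W' y) ->
    \forall y \near x, contraction X' zeta y = 0.
  move=> X'0 zE; apply: filterS3 OmT X'0 zE => y OT x0 zy.
  by rewrite contractionE zy trmx_mul OT mulmxN mulNmx -mulmxA x0 mulmx0 oppr0 mxE.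
have pE : \forall y \near x, contraction X eta y - contraction Y xi y = 0.
  by apply: filterS2 (c0 _ _ _ X0 etaE) (c0 _ _ _ Y0 xiE) => y -> ->; rewrite subr0.
have -> : courant_form X xi Y eta x = lie_deriv_form X eta x - lie_deriv_form Y xi x.
  rewrite /courant_form (ext_diff_near pE) (_ : ext_diff _ _ = 0) ?scaler0 ?subr0 //.
  by apply/matrixP => i j; rewrite !mxE partialC_cst.
rewrite (lie_deriv_form_near _ etaE) (lie_deriv_form_near _ xiE) !cart //.
by rewrite mulmxBr.
Qed.

End ClosedForms.

(** * Naturality on a manifold *)

Section SmoothMatrices.
Context {R : realType} {n : nat}.
Local Notation C := R[i].
Local Notation contraction := Defs.contraction.
Variables (U : set 'cV[R]_n) (oU : open U).

Lemma smooth_mxM p q r (F : 'cV[R]_n -> 'M[R]_(p, q)) (G : 'cV[R]_n -> 'M[R]_(q, r)) :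
  smooth_mx U F -> smooth_mx U G -> smooth_mx U (fun x => F x *m G x).
Proof.
move=> sF sG i j; under eq_fun do rewrite mxE.
by apply: smooth_sum => // k; exact: smoothM.
Qed.

Lemma smooth_mxZ p q (c : R) (F : 'cV[R]_n -> 'M[R]_(p, q)) :
  smooth_mx U F -> smooth_mx U (fun x => c *: F x).
Proof.
by move=> sF i j; under eq_fun do rewrite mxE; apply: smoothM => //; exact: smooth_cst.
Qed.

Lemma smooth_mx_tr p q (F : 'cV[R]_n -> 'M[R]_(p, q)) :
  smooth_mx U F -> smooth_mx U (fun x => (F x)^T).
Proof. by move=> sF i j; under eq_fun do rewrite mxE; exact: sF. Qed.

Lemma smooth_block_mx p1 p2 q1 q2 (Fa : 'cV[R]_n -> 'M[R]_(p1, q1))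
    (Fb : 'cV[R]_n -> 'M[R]_(p1, q2)) (Fc : 'cV[R]_n -> 'M[R]_(p2, q1))
    (Fd : 'cV[R]_n -> 'M[R]_(p2, q2)) :
  smooth_mx U Fa -> smooth_mx U Fb -> smooth_mx U Fc -> smooth_mx U Fd ->
  smooth_mx U (fun x => block_mx (Fa x) (Fb x) (Fc x) (Fd x)).
Proof.
move=> sa sb sc sd i j.
under eq_fun do rewrite mxE.
case: (fintype.split i) => i'; under eq_fun do rewrite mxE; case: (fintype.split j) => j';
  first [exact: sa|exact: sb|exact: sc|exact: sd].
Qed.

Lemma smooth_det p (F : 'cV[R]_n -> 'M[R]_p) :
  smooth_mx U F -> smooth U (fun x => \det (F x)).
Proof.
move=> sF; rewrite /determinant; apply: smooth_sum => // s.
apply: smoothM => //; first exact: smooth_cst.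
by apply: smooth_prod => // i; exact: sF.
Qed.

Lemma smooth_invmx p (F : 'cV[R]_n -> 'M[R]_p) :
  smooth_mx U F -> (forall x, U x -> F x \in unitmx) ->
  smooth_mx U (fun x => invmx (F x)).
Proof.
move=> sF uF i j.
(* Cramer's rule. [invmx] returns a singular matrix unchanged, so the formula is claimed on [U]
   only. *)
apply: (@smooth_eq _ _ U (fun x => (\det (F x))^-1 * cofactor (F x) j i)) => //.
  by move=> x Ux; rewrite /invmx uF // !mxE.
apply: smoothM => //; first apply: smoothV => //.
- by move=> x /uF; rewrite unitmxE unitfE.
- exact: smooth_det.
apply: smoothM => //; first exact: smooth_cst.
apply: smooth_det => k l; under eq_fun do rewrite !mxE; exact: sF.
Qed.

Implicit Types (X Y xi eta : 'cV[R]_n -> 'cV[C]_n).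

Lemma smoothC_contraction X eta :
  smooth_mxC U X -> smooth_mxC U eta -> smoothC U (contraction X eta).
Proof. by move=> sX se; apply: smoothC_sum => // i; apply: smoothCM. Qed.

Lemma smooth_lie_bracket X Y :
  smooth_mxC U X -> smooth_mxC U Y -> smooth_mxC U (lie_bracket X Y).
Proof.
move=> sX sY i j; change (smoothC U (fun y => lie_bracket X Y y i j)).
under eq_fun do rewrite mxE.
apply: smoothC_sum => // k; apply: smoothCD => //; last apply: smoothCN => //.
  by apply: smoothCM => //; apply: smoothC_partial; exact: sY.
by apply: smoothCM => //; apply: smoothC_partial; exact: sX.
Qed.

Lemma smooth_lie_deriv_form X eta :
  smooth_mxC U X -> smooth_mxC U eta -> smooth_mxC U (lie_deriv_form X eta).
Proof.
move=> sX se i j; change (smoothC U (fun y => lie_deriv_form X eta y i j)).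
under eq_fun do rewrite mxE.
apply: smoothC_sum => // k; apply: smoothCD => //.
  by apply: smoothCM => //; apply: smoothC_partial; exact: se.
by apply: smoothCM => //; apply: smoothC_partial; exact: sX.
Qed.

Lemma smooth_courant_form X Y xi eta : smooth_mxC U X -> smooth_mxC U Y ->
  smooth_mxC U xi -> smooth_mxC U eta -> smooth_mxC U (courant_form X xi Y eta).
Proof.
move=> sX sY sx se i j; change (smoothC U (fun y => courant_form X xi Y eta y i j)).
have -> : (fun y => courant_form X xi Y eta y i j)
    = (fun y => lie_deriv_form X eta y i j - lie_deriv_form Y xi y i j
        - 2^-1 * partialC i (fun y => contraction X eta y - contraction Y xi y) y).
  by apply/funext => y; rewrite !mxE.
apply: smoothCD => //; last apply: smoothCN => //.
  apply: smoothCD => //; last apply: smoothCN => //.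
    exact: (smooth_lie_deriv_form sX se).
  exact: (smooth_lie_deriv_form sY sx).
apply: smoothCM => //; first exact: smoothC_cst.
apply: smoothC_partial; apply: smoothCD => //; last apply: smoothCN => //.
  exact: smoothC_contraction.
exact: smoothC_contraction.
Qed.

End SmoothMatrices.

(** * Chart overlaps and global sections *)

Section Manifold.
Context {R : realType} {n : nat} {M : manifold R n}.
Local Notation C := R[i].
Local Notation contraction := Defs.contraction.
Implicit Types (i j : chart M) (x : 'cV[R]_n).

Lemma img_open i : open (img i).
Proof. exact: coord_open. Qed.

Lemma overlap_img i j : overlap i j `<=` img i.
Proof. by move=> x [p [pi _] <-]; exists p. Qed.

(** This description exhibits the overlap as a preimage under [param i], whose continuity on [img i]
    then makes it open. *)
Lemma overlap_param i j x : overlap i j x <-> img i x /\ dom j (param i x).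
Proof.
split=> [[p [pi pj] <-]|[[p pi <-]]]; last by rewrite coordK //; exists p.
by split; [exists p|rewrite coordK].
Qed.

Lemma overlap_open i j : open (overlap i j).
Proof.
rewrite openE => x /overlap_param[ix jx]; rewrite /interior.
have ni : nbhs x (img i) by apply: open_nbhs_nbhs; split; [exact: img_open|].
have nj : nbhs x (param i @^-1` dom j).
  by apply: (param_continuous ix); apply: open_nbhs_nbhs; split; [exact: dom_open|].
apply: filterS2 ni nj => y iy jy; exact/overlap_param.
Qed.

Lemma transition_overlap i j x : overlap i j x -> overlap j i (transition i j x).
Proof. by move=> [p [pi pj] <-]; rewrite /transition /= coordK //; exists p. Qed.

Lemma transitionK i j x : overlap i j x -> transition j i (transition i j x) = x.
Proof. by move=> [p [pi pj] <-]; rewrite /transition /= coordK // coordK. Qed.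

Lemma smooth_transition i j : smooth_mx (overlap i j) (transition i j).
Proof. exact: transition_smooth. Qed.

Lemma jac_comp (F G : 'cV[R]_n -> 'cV[R]_n) x :
  (forall k, differentiable (fun y => F y k 0) x) ->
  (forall k, differentiable (fun y => G y k 0) (F x)) ->
  jac (fun y => G (F y)) x = jac G (F x) *m jac F x.
Proof.
move=> dF dG; apply/matrixP => k l; rewrite !mxE.
rewrite (@partial_comp _ _ l (fun y => G y k 0)) //.
by apply: eq_bigr => m _; rewrite [jac G _ _ _]mxE.
Qed.

Lemma jac_id x : jac (fun y : 'cV[R]_n => y) x = 1%:M.
Proof.
apply/matrixP => k l; rewrite !mxE /partial.
have := @derive_mx R _ _ _ (fun y : 'cV[R]_n => y) x (delta_mx l 0).
rewrite derive_id => /(_ (@derivable_id _ _ x _)) /matrixP /(_ k 0).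
by rewrite !mxE eqxx andbT.
Qed.

(** The chain rule applied to [transitionK], which holds near [x] because the overlap is open. *)
Lemma jac_transition_unit i j x : overlap i j x -> jac (transition i j) x \in unitmx.
Proof.
move=> ox; have oy := transition_overlap ox.
suff : jac (transition j i) (transition i j x) *m jac (transition i j) x = 1%:M.
  by case/mulmx1_unit.
rewrite -jac_comp -?(jac_id x).
- apply/matrixP => k l; rewrite !mxE; apply: partial_near_eq.
  by apply: filterS (open_near (@overlap_open i j) ox (@transitionK i j)) => y /= ->.
- by move=> k; apply: (smooth_differentiable (smooth_transition i j k 0)).
- by move=> k; apply: (smooth_differentiable (smooth_transition j i k 0)).
Qed.

Definition vector_part (s : 'cV[R]_n -> 'cV[C]_(n + n)) x : 'cV[C]_n := usubmx (s x).
Definition form_part (s : 'cV[R]_n -> 'cV[C]_(n + n)) x : 'cV[C]_n := dsubmx (s x).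

Lemma courantE (a b : 'cV[R]_n -> 'cV[C]_(n + n)) x :
  courant a b x = col_mx (lie_bracket (vector_part a) (vector_part b) x)
    (courant_form (vector_part a) (form_part a) (vector_part b) (form_part b) x).
Proof. by []. Qed.

Lemma smooth_vector_part U (s : 'cV[R]_n -> 'cV[C]_(n + n)) :
  smooth_mxC U s -> smooth_mxC U (vector_part s).
Proof.
move=> ss k l; under eq_fun do rewrite mxE.
by under [X in _ /\ smooth _ X]eq_fun do rewrite mxE; exact: ss.
Qed.

Lemma smooth_form_part U (s : 'cV[R]_n -> 'cV[C]_(n + n)) :
  smooth_mxC U s -> smooth_mxC U (form_part s).
Proof.
move=> ss k l; under eq_fun do rewrite mxE.
by under [X in _ /\ smooth _ X]eq_fun do rewrite mxE; exact: ss.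
Qed.

Lemma smooth_mxC_diff U p q (F : 'cV[R]_n -> 'M[C]_(p, q)) x :
  smooth_mxC U F -> U x -> diffCmx F x.
Proof. by move=> sF Ux k l; exact: (smoothC_diff (sF k l)). Qed.

Lemma complexify_gen_change (A : 'M[R]_n) (u : 'cV[C]_(n + n)) :
  complexify (gen_change A) *m u
  = col_mx (complexify A *m usubmx u) ((invmx (complexify A))^T *m dsubmx u).
Proof.
rewrite -{1}(vsubmxK u) /gen_change /complexify map_block_mx mul_block_col.
by rewrite !map_mx0 !mul0mx addr0 add0r -map_trmx map_invmx.
Qed.

(** Smoothness holds chart by chart; the transformation law combines the naturality of the bracket,
    of the two Lie derivatives and of the differential of the pairings. *)
Lemma courant_gen_section (a b : components (M := M) 'cV[C]_(n + n)) :
  is_gen_section a -> is_gen_section b ->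
  is_gen_section (fun i => courant (a i) (b i)).
Proof.
move=> [sa ta] [sb tb]; split=> [i|i j x ox].
  move=> k l; change (smoothC (img i) (fun y => courant (a i) (b i) y k l)).
  under eq_fun do rewrite courantE mxE.
  have sX s := smooth_vector_part (s := s); have sf s := smooth_form_part (s := s).
  case: (fintype.split k) => k'.
    exact: (smooth_lie_bracket (@img_open i) (sX _ _ (sa i)) (sX _ _ (sb i))).
  exact: (smooth_courant_form (@img_open i) (sX _ _ (sa i)) (sX _ _ (sb i)) (sf _ _ (sa i)) (sf _ _ (sb i))).
have oU := @overlap_open i j; have sF := smooth_transition i j.
set F := transition i j in sF *; have oy : overlap j i (F x) := transition_overlap ox.
have Aunit y : overlap i j y -> complexify (jac F y) \in unitmx.
  by move=> oy'; rewrite map_unitmx; exact: jac_transition_unit.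
have vecF s : (forall y, overlap i j y -> s j (F y) = complexify (gen_change (jac F y)) *m s i y) ->
  forall y, overlap i j y -> vector_part (s j) (F y) = complexify (jac F y) *m vector_part (s i) y.
  by move=> ts y /ts; rewrite complexify_gen_change /vector_part => ->; rewrite col_mxKu.
(* The covector law is solved for the source chart, so that no inverse Jacobian has to be
   differentiated. *)
have formF s : (forall y, overlap i j y -> s j (F y) = complexify (gen_change (jac F y)) *m s i y) ->
  forall y, overlap i j y -> form_part (s i) y = (complexify (jac F y))^T *m form_part (s j) (F y).
  move=> ts y oy'; rewrite /form_part ts // complexify_gen_change col_mxKd mulmxA.
  by rewrite -trmx_mul mulVmx ?Aunit // trmx1 mul1mx.
have dvec i' y s : is_gen_section s -> img i' y -> diffCmx (vector_part (s i')) y.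
  by move=> [ss _] iy; apply: (smooth_mxC_diff _ iy); exact: smooth_vector_part.
have dform i' y s : is_gen_section s -> img i' y -> diffCmx (form_part (s i')) y.
  by move=> [ss _] iy; apply: (smooth_mxC_diff _ iy); exact: smooth_form_part.
have ix := overlap_img ox; have jy := overlap_img oy.
have ga : is_gen_section a by [].
have gb : is_gen_section b by [].
rewrite !courantE complexify_gen_change col_mxKu col_mxKd; congr col_mx.
  by apply: (lie_bracket_change oU ox sF (vecF a (ta i j)) (vecF b (tb i j))); exact: dvec.
set D := courant_form _ _ _ _ (F x).
suff -> : courant_form (vector_part (a i)) (form_part (a i)) (vector_part (b i)) (form_part (b i)) x
    = (complexify (jac F x))^T *m D.
  by rewrite mulmxA -trmx_mul mulmxV ?Aunit // trmx1 mul1mx.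
rewrite /D /courant_form mulmxBr mulmxBr -scalemxAr; congr (_ - _ - _ *: _).
- by apply: (lie_deriv_form_change oU ox sF (vecF a (ta i j)) (formF b (tb i j)));
    [exact: dvec|exact: dvec|exact: dform].
- by apply: (lie_deriv_form_change oU ox sF (vecF b (tb i j)) (formF a (ta i j)));
    [exact: dvec|exact: dvec|exact: dform].
have dF := smooth_mx_coord ox sF.
rewrite -ext_diff_comp //.
  apply: ext_diff_near.
  (* The equality is needed on the whole overlap, since both sides are about to be
     differentiated. *)
  have cF y : overlap i j y -> contraction (vector_part (a i)) (form_part (b i)) y
      - contraction (vector_part (b i)) (form_part (a i)) y
    = contraction (vector_part (a j)) (form_part (b j)) (F y)
      - contraction (vector_part (b j)) (form_part (a j)) (F y).
    move=> oy'; congr (_ - _).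
      exact: (contraction_change oy' (vecF a (ta i j) y oy') (formF b (tb i j) y oy')).
    exact: (contraction_change oy' (vecF b (tb i j) y oy') (formF a (ta i j) y oy')).
  exact: (open_near oU ox cF).
apply: diffCD.
  by apply: diffC_contraction; [exact: dvec|exact: dform].
under eq_fun do rewrite -mulN1r.
apply: diffCM; first exact: diffC_cst.
by apply: diffC_contraction; [exact: dvec|exact: dform].
Qed.

End Manifold.

(** * The eigenbundles of the interpolation *)

Section QuaternionicAlgebra.
Context {R : realType} {n : nat}.
Implicit Types g I J K : 'M[R]_n.

(** A row vector [v] with [v *m g = 0] has zero square norm, so it vanishes. *)
Lemma posdef_unit g :
  (forall v : 'cV[R]_n, v != 0 -> 0 < (v^T *m g *m v) 0 0) -> g \in unitmx.
Proof.
move=> pos; rewrite -row_free_unit -kermx_eq0; apply/rowV0P => v /sub_kermxP vg.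
apply/eqP; case: (eqVneq v^T 0) => [v0|/pos].
  by rewrite -(trmxK v) v0 trmx0.
by rewrite trmxK vg mul0mx mxE ltxx.
Qed.

(** Multiply the invariance of [g] on the right by [I] and use [I *m I = - 1%:M]. *)
Lemma hermitian_skew g I : I *m I = - 1%:M -> I^T *m g *m I = g ->
  I^T *m g = - (g *m I).
Proof.
move=> I2 gI; rewrite -{2}gI -mulmxA I2 mulmxN mulmx1 opprK //.
Qed.

Lemma sq_opp1_unit I : I *m I = - 1%:M -> I \in unitmx.
Proof.
move=> I2; have /mulmx1_unit[//] : (- I) *m I = 1%:M.
by rewrite mulNmx I2 opprK.
Qed.

Lemma quaternion_forms g I J K :
  I *m I = - 1%:M -> I^T *m g *m I = g -> I *m J = K -> K = - (J *m I) ->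
  [/\ g *m J *m I = - (g *m K), I^T *m (g *m J) = - (g *m K)
    & I^T *m (g *m K) = g *m J].
Proof.
move=> I2 gI IJ JI; have Ig := hermitian_skew I2 gI; split.
- by rewrite -mulmxA [K]JI mulmxN opprK.
- by rewrite mulmxA Ig mulNmx -mulmxA IJ.
- by rewrite mulmxA Ig mulNmx -mulmxA -IJ (mulmxA I) I2 mulNmx mul1mx mulmxN opprK.
Qed.

End QuaternionicAlgebra.

(** * Linear algebra of the eigenbundle at one point, over an arbitrary field *)

Section Eigenbundle.
Context {F : fieldType} {n : nat}.
Variables (I w k v : 'M[F]_n) (i s c : F).
Hypotheses (wv : w *m v = 1%:M) (vw : v *m w = 1%:M).
Hypotheses (wI : w *m I = - k) (Iw : I^T *m w = - k) (Ik : I^T *m k = w).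
Hypotheses (i2 : i * i = -1) (sc : s ^+ 2 + c ^+ 2 = 1) (two0 : (2 : F) != 0).
Local Notation P := (block_mx (- s *: I) (- c *: v) (c *: w) (s *: I^T)).

(** The diagonal blocks give [-(s^2 + c^2)]; the off-diagonal ones cancel since [w] and [v]
    intertwine [I] with [I^T]. *)
Lemma interpolation_sq : I *m I = - 1%:M -> P *m P = - 1%:M.
Proof.
move=> I2; have It2 : I^T *m I^T = - 1%:M by rewrite -trmx_mul I2 linearN /= trmx1.
have Iv : I *m v = v *m I^T.
  transitivity (v *m (w *m I) *m v); first by rewrite mulmxA vw mul1mx.
  by rewrite wI -Iw -!mulmxA wv mulmx1.
rewrite mulmx_block -!scalemxAl -!scalemxAr !scalerA I2 It2 Iv vw wv wI Iw.
have -> : (- 1%:M : 'M[F]_(n + n)) = block_mx (- 1%:M) 0 0 (- 1%:M).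
  by rewrite [in LHS]scalar_mx_block opp_block_mx !oppr0.
have c2 : c * c = 1 - s * s by rewrite -!expr2 -sc addrAC subrr add0r.
congr block_mx; apply/matrixP => a b; rewrite !mxE ?mulNr ?mulrN ?c2; ring.
Qed.

(* S is twice the matrix of the pairing, so that P is skew with respect to it. *)
Lemma interpolation_skew (S := block_mx 0 1%:M 1%:M 0 : 'M[F]_(n + n)) :
  w^T = - w -> v^T = - v -> P^T *m S = - (S *m P).
Proof.
move=> wT vT; rewrite /S tr_block_mx !linearZ /= wT vT trmxK !mulmx_block opp_block_mx.
rewrite !(mulmx0, mul0mx, mulmx1, mul1mx, addr0, add0r).
by rewrite !scaleNr !scalerN !opprK.
Qed.

Lemma eigen_rows (X xi : 'cV[F]_n) : P *m col_mx X xi = i *: col_mx X xi <->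
  - s *: (I *m X) - c *: (v *m xi) = i *: X
  /\ c *: (w *m X) + s *: (I^T *m xi) = i *: xi.
Proof.
rewrite mul_block_col scale_col_mx -!scalemxAl [- c *: _]scaleNr.
by split=> [/eq_col_mx//|[-> ->]].
Qed.

(** Applying [w] to the first row and dividing by [c] solves for [xi]. For such [xi] the second row
    follows from [i^2 = -1] and [s^2 + c^2 = 1]. *)
Lemma eigen_graph (X xi : 'cV[F]_n) : c != 0 ->
  P *m col_mx X xi = i *: col_mx X xi <->
  xi = ((s / c) *: k + (- i / c) *: w) *m X.
Proof.
move=> c0; apply: iff_trans (eigen_rows X xi) _; rewrite mulmxDl -!scalemxAl; split.
  case=> [E1 _]; have := congr1 (mulmx w) E1.
  rewrite mulmxBr -!scalemxAr !mulmxA wI wv mul1mx mulNmx.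
  move: (k *m X) (w *m X) => kX wX E; apply/matrixP => a b.
  have := congr1 (fun m : 'cV[F]_n => m a b) E; rewrite !mxE => Eab.
  apply: (mulfI c0); transitivity (s * kX a b - i * wX a b); last by field.
  by rewrite -Eab; ring.
move=> ->.
have vk : v *m k = - I by rewrite -[k]opprK -wI mulmxN mulmxA vw mul1mx.
split.
  rewrite mulmxDr -!scalemxAr !mulmxA vk vw mul1mx mulNmx.
  by apply/matrixP => a b; rewrite !mxE; field.
rewrite mulmxDr -!scalemxAr !mulmxA Ik Iw mulNmx.
have s2 : s * s = 1 - c * c by rewrite -!expr2 -sc addrK.
move: (w *m X) (k *m X) => wX kX; apply/matrixP => a b; rewrite !mxE.
apply: (mulfI c0).
transitivity (c * c * wX a b + s * s * wX a b + i * s * kX a b); first by field.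
transitivity (i * s * kX a b - i * i * wX a b); last by field.
by rewrite s2 i2; ring.
Qed.

(** [I^T] sends [k - i w] to [w + i k = i (k - i w)]. *)
Lemma eigen_image (Z : 'cV[F]_n) :
  I^T *m ((k - i *: w) *m Z) = i *: ((k - i *: w) *m Z).
Proof.
rewrite mulmxA mulmxBr -scalemxAr Ik Iw scalemxAl scalerBr scalerA i2.
by rewrite scalerN opprK scaleN1r opprK addrC.
Qed.

(** As [w] is invertible, the kernel of [k - i w] is the eigenspace of [I] for [-i], that is, of the
    block [-I] for [i]. *)
Lemma kernel_formE (X : 'cV[F]_n) :
  (k - i *: w) *m X = - (w *m (I *m X + i *: X)).
Proof.
by rewrite mulmxDr mulmxA wI mulmxBl -scalemxAl -scalemxAr mulNmx opprD opprK.
Qed.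

(** The factor [i / 2] arises because [k - i w] sends [v xi] to [-I^T xi - i xi = -2 i xi]. *)
Lemma eigen_kernel (X xi : 'cV[F]_n) : c = 0 -> s = 1 ->
  P *m col_mx X xi = i *: col_mx X xi ->
  (k - i *: w) *m X = 0
  /\ xi = (k - i *: w) *m ((i / 2) *: (v *m xi)).
Proof.
move=> c0 s1 /eigen_rows.
rewrite c0 s1 !scale0r subr0 add0r scaleN1r scale1r => -[EX Exi]; split.
  by rewrite kernel_formE -EX subrr mulmx0 oppr0.
have kv : k *m v = - I^T by rewrite -[k]opprK -Iw mulNmx -mulmxA wv mulmx1.
rewrite -scalemxAr mulmxBl -scalemxAl !mulmxA kv wv mul1mx mulNmx Exi.
apply/matrixP => a b; rewrite !mxE.
transitivity (- (i * i) * xi a b); first by rewrite i2; ring.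
by field.
Qed.

(** Converse of [eigen_kernel] for an arbitrary potential [Z]; it recognises the computed bracket as
    a section of the eigenbundle. *)
Lemma kernel_eigen (X Z : 'cV[F]_n) : c = 0 -> s = 1 ->
  (k - i *: w) *m X = 0 ->
  P *m col_mx X ((k - i *: w) *m Z) = i *: col_mx X ((k - i *: w) *m Z).
Proof.
move=> c0 s1 /eqP; rewrite kernel_formE oppr_eq0 => /eqP/(congr1 (mulmx v)).
rewrite mulmx0 mulmxA vw mul1mx => E; apply/eigen_rows.
rewrite c0 s1 !scale0r subr0 add0r scaleN1r scale1r eigen_image; split=> //.
by apply/eqP; rewrite eq_sym -addr_eq0 addrC E.
Qed.

End Eigenbundle.

(** * Constant complex combinations of two real 2-forms *)

Section ClosedCombination.
Context {R : realType} {n : nat}.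
Local Notation C := R[i].
Variables (U : set 'cV[R]_n) (k w : 'cV[R]_n -> 'M[R]_n) (al be : C).
Hypotheses (oU : open U) (sk : smooth_mx U k) (sw : smooth_mx U w).

Definition form_combination y : 'M[C]_n := al *: complexify (k y) + be *: complexify (w y).

Lemma diffCmx_complexify p q (F : 'cV[R]_n -> 'M[R]_(p, q)) x : smooth_mx U F -> U x ->
  diffCmx (fun y => complexify (F y)) x.
Proof.
move=> sF Ux i j; under eq_fun do rewrite mxE.
by apply: diffC_real; exact: (smooth_differentiable (sF i j)).
Qed.

Lemma diffCmx_combination x : U x -> diffCmx form_combination x.
Proof.
move=> Ux i j; under eq_fun do rewrite !mxE.
have dr (F : 'cV[R]_n -> 'M[R]_n) : smooth_mx U F -> diffC (fun y => (F y i j)%:C%C) x.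
  by move=> sF; apply: diffC_real; exact: (smooth_differentiable (sF i j)).
by apply: diffCD; apply: diffCM; (try exact: diffC_cst); exact: dr.
Qed.

Lemma tr_combination y : (k y)^T = - k y -> (w y)^T = - w y ->
  (form_combination y)^T = - form_combination y.
Proof.
move=> kT wT; rewrite /form_combination /complexify linearD !linearZ /=.
by rewrite !map_trmx kT wT !map_mxN !scalerN opprD.
Qed.

Lemma closed_combination x (a b c : 'I_n) : U x ->
  partial a (fun y => k y c b) x + partial b (fun y => k y a c) x
    + partial c (fun y => k y b a) x = 0 ->
  partial a (fun y => w y c b) x + partial b (fun y => w y a c) x
    + partial c (fun y => w y b a) x = 0 ->
  partialC a (fun y => form_combination y c b) x
    + partialC b (fun y => form_combination y a c) x
    + partialC c (fun y => form_combination y b a) x = 0.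
Proof.
move=> Ux kc wc.
have E d p q : partialC d (fun y => form_combination y p q) x
    = al * (partial d (fun y => k y p q) x)%:C%C + be * (partial d (fun y => w y p q) x)%:C%C.
  under eq_fun do rewrite !mxE.
  have dr (F : 'cV[R]_n -> 'M[R]_n) : smooth_mx U F -> diffC (fun y => (F y p q)%:C%C) x.
    by move=> sF; apply: diffC_real; exact: (smooth_differentiable (sF p q)).
  rewrite partialCD; [|by apply: diffCM; [exact: diffC_cst|exact: dr]..].
  by rewrite !partialCZ ?partialC_real //; exact: dr.
rewrite !E.
have -> : forall x1 x2 x3 y1 y2 y3 : C, al * x1 + be * y1 + (al * x2 + be * y2)
    + (al * x3 + be * y3) = al * (x1 + x2 + x3) + be * (y1 + y2 + y3).
  by move=> *; ring.
by rewrite -!rmorphD kc wc !rmorph0 !mulr0 addr0.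
Qed.

End ClosedCombination.

(** * The interpolating family on a hyperkähler manifold *)

Section Hyperkahler.
Context {R : realType} {n : nat} {M : manifold R n}.
Local Notation C := R[i].
Variables g I J K : components (M := M) 'M[R]_n.
Hypothesis hK : is_hyperkahler g I J K.
Implicit Types (i j : chart M) (x : 'cV[R]_n).

Local Notation w := (kahler_form g J).
Local Notation k := (kahler_form g K).

Lemma hyper_metric_unit i x : img i x -> g i x \in unitmx.
Proof. by case: hK => -[[_ _ pos] _ _ _] _ _ _ _ ix; apply: posdef_unit; exact: pos. Qed.

Lemma kahler_form_tr (L : components (M := M) 'M[R]_n) i x :
  is_kahler g L -> img i x -> (kahler_form g L i x)^T = - kahler_form g L i x.
Proof.
move=> [[_ gT _] [_ L2 _] gL _] ix.
by rewrite /kahler_form trmx_mul gT // hermitian_skew ?L2 ?gL.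
Qed.

Lemma kahler_form_bilin (L : components (M := M) 'M[R]_n) :
  is_kahler g L -> is_bilin (kahler_form g L).
Proof.
move=> [[[sg tg] _ _] [[sL tL] _ _] _ _]; split=> [i|i j x ox A].
  exact: (smooth_mxM (@img_open _ _ _ i)).
by rewrite /kahler_form (tg _ _ _ ox) -!mulmxA -(tL _ _ _ ox).
Qed.

Lemma hyper_forms i x : img i x ->
  [/\ w i x *m I i x = - k i x, (I i x)^T *m w i x = - k i x
    & (I i x)^T *m k i x = w i x].
Proof.
case: hK => -[_ [_ I2 _] gI _] _ _ IJ JI ix.
by apply: quaternion_forms; [exact: I2|exact: gI|exact: IJ|exact: JI].
Qed.

Lemma hyper_form_unit i x : img i x -> w i x \in unitmx.
Proof.
move=> ix; rewrite unitmx_mul hyper_metric_unit //=.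
by case: hK => _ [_ [_ J2 _] _ _] _ _ _; apply: sq_opp1_unit; exact: J2.
Qed.

Lemma hyper_symplectic : is_symplectic_form w.
Proof.
have hJ : is_kahler g J by case: hK.
split; last by move=> i x; exact: hyper_form_unit.
  by split; [exact: kahler_form_bilin|move=> i x; exact: kahler_form_tr].
by case: hJ.
Qed.

Lemma interpolationE t i x : interpolation g I J t i x =
  block_mx (- sin t *: I i x) (- cos t *: invmx (w i x))
    (cos t *: w i x) (sin t *: (I i x)^T).
Proof.
rewrite /interpolation /gen_of_complex /gen_of_symplectic !scale_block_mx add_block_mx.
by rewrite !scaler0 !addr0 !add0r !scalerN !scaleNr.
Qed.

Lemma smooth_kahler_inv i : smooth_mx (img i) (fun x => invmx (w i x)).
Proof.
have hJ : is_kahler g J by case: hK.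
apply: smooth_invmx; [exact: img_open|exact: (kahler_form_bilin hJ).1|].
exact: hyper_form_unit.
Qed.

Lemma interpolation_gen_endo t : is_gen_endo (interpolation g I J t).
Proof.
have [[_ [[sI tI] _ _] _ _] hJ _ _ _] := hK.
have [sw tw] := kahler_form_bilin hJ.
split=> [i|i j x ox A].
  have oi := @img_open _ _ _ i.
  have -> : interpolation g I J t i = fun x => block_mx (- sin t *: I i x)
      (- cos t *: invmx (w i x)) (cos t *: w i x) (sin t *: (I i x)^T).
    by apply/funext => x; exact: interpolationE.
  have swi := smooth_kahler_inv i.
  apply: smooth_block_mx; apply: smooth_mxZ => //.
  exact: smooth_mx_tr.
have Au : jac (transition i j) x \in unitmx := jac_transition_unit ox.
have wu := hyper_form_unit (overlap_img ox).
have wu' := hyper_form_unit (overlap_img (transition_overlap ox)).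
have := tI _ _ _ ox; have := tw _ _ _ ox; rewrite /A !interpolationE /gen_change.
move: (jac _ x) (w i x) (w j _) (I i x) (I j _) Au wu wu' => B w1 w2 I1 I2 Bu w1u w2u /= tw' tI'.
rewrite !mulmx_block !(mulmx0, mul0mx, addr0, add0r) -!scalemxAl -!scalemxAr.
(* The blocks of the intertwining relation: [wB] is the tensor law of the Kähler form, [E3] its
   inverse, and [E4] the transpose of the law for [I]. *)
have wB : w2 *m B = (invmx B)^T *m w1.
  by rewrite tw' !mulmxA -trmx_mul mulmxV // trmx1 mul1mx.
have E3 : invmx w2 *m (invmx B)^T = B *m invmx w1.
  have := congr1 (fun m => invmx w2 *m m *m invmx w1) wB.
  by rewrite mulKmx // -!mulmxA mulmxV // mulmx1.
have E4 : I2^T *m (invmx B)^T = (invmx B)^T *m I1^T.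
  rewrite -!trmx_mul; congr trmx.
  have := congr1 (fun m => invmx B *m m *m invmx B) tI'.
  by rewrite mulKmx // -!mulmxA mulmxV // mulmx1.
by rewrite tI' wB E3 E4.
Qed.

(** This puts the pairing in terms of the matrix [S] of [interpolation_skew]. *)
Lemma pairing_flip (u v : 'cV[R]_(n + n)) :
  pairing u v = 2^-1 * (u^T *m block_mx 0 1%:M 1%:M 0 *m v) 0 0.
Proof.
rewrite /pairing; congr (_ * _).
rewrite -{3}(vsubmxK u) -{3}(vsubmxK v) tr_col_mx mul_row_block.
rewrite !mulmx0 !mulmx1 add0r addr0 mul_row_col [RHS]mxE; congr (_ + _).
by rewrite -[in RHS](trmxK (dsubmx v)) -trmx_mul [RHS]mxE.
Qed.

Lemma interpolation_almost_complex t : is_gen_almost_complex (interpolation g I J t).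
Proof.
have sq i x : img i x -> interpolation g I J t i x *m interpolation g I J t i x = - 1%:M.
  move=> ix; have [wI Iw Ik] := hyper_forms ix; have wu := hyper_form_unit ix.
  rewrite interpolationE; apply: (interpolation_sq (k := k i x)) => //.
  - exact: mulmxV.
  - exact: mulVmx.
  - by rewrite addrC cos2Dsin2.
  - by case: hK => -[_ [_ I2 _] _ _] _ _ _ _; exact: I2.
split=> //; first exact: interpolation_gen_endo.
move=> i x ix u v; rewrite !pairing_flip; congr (_ * _).
have wT : (w i x)^T = - w i x by apply: kahler_form_tr => //; case: hK.
have := @interpolation_skew _ _ (I i x) (w i x) (invmx (w i x)) (sin t) (cos t).
rewrite -interpolationE => skew.
(* For [P] skew with respect to [S] and of square [-1], one has [P^T S P = - S P P = S]:
   orthogonality follows. *)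
rewrite trmx_mul -!mulmxA (mulmxA _^T (block_mx _ _ _ _)) skew //.
  by rewrite mulNmx -!mulmxA (mulmxA (interpolation g I J t i x)) sq // mulNmx mul1mx !mulmxN opprK.
(* What remains is that the inverse of the skew matrix [w i x] is skew. *)
have wu := hyper_form_unit ix; rewrite -[LHS](mulKmx wu).
by rewrite -[X in X *m _^T]opprK -wT mulNmx -trmx_mul mulVmx // trmx1 mulmxN mulmx1.
Qed.

Lemma eigen_section t s i x : plus_i_section (interpolation g I J t) s -> img i x ->
  block_mx (- (sin t)%:C%C *: complexify (I i x)) (- (cos t)%:C%C *: complexify (invmx (w i x)))
    ((cos t)%:C%C *: complexify (w i x)) ((sin t)%:C%C *: (complexify (I i x))^T)
    *m col_mx (vector_part (s i) x) (form_part (s i) x)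
  = 'i%C *: col_mx (vector_part (s i) x) (form_part (s i) x).
Proof.
by move=> [_ es] ix; rewrite /vector_part /form_part vsubmxK -es // interpolationE
  /complexify map_block_mx !map_mxZ !rmorphN map_trmx.
Qed.

(** Both cases rewrite the eigenbundle near [x] through one closed complex 2-form, compute the
    bracket there, and return through the converse characterisation at [x]. *)
Lemma interpolation_integrable t : 0 <= t <= pi / 2 -> integrable_gen (interpolation g I J t).
Proof.
move=> /andP[t0 tpi] a b Ha Hb; split.
  by apply: courant_gen_section; [case: Ha|case: Hb].
move=> i x ix; have [[[sa _] _] [[sb _] _]] := (Ha, Hb).
have oi := @img_open _ _ _ i.
have [_ hJ kK _ _] := hK.
have [[sw _] [sk _]] := (kahler_form_bilin hJ, kahler_form_bilin kK).
have cw : closed_2form w by case: hJ.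
have ck : closed_2form k by case: kK.
have dX s : smooth_mxC (img i) (s i) -> diffCmx (vector_part (s i)) x.
  by move=> ss; apply: (smooth_mxC_diff _ ix); exact: smooth_vector_part.
have dxi s : smooth_mxC (img i) (s i) -> diffCmx (form_part (s i)) x.
  by move=> ss; apply: (smooth_mxC_diff _ ix); exact: smooth_form_part.
(* One family covers both cases: coefficients [1] and [-i] when [cos t = 0], and [sin t / cos t] and
   [-i / cos t] otherwise. *)
pose Om al be y : 'M[C]_n := form_combination (k i) (w i) al be y.
have dOm al be : diffCmx (Om al be) x by apply: diffCmx_combination.
have OmT al be : \forall y \near x, (Om al be y)^T = - Om al be y.
  apply: (open_near oi ix) => y iy.
  by apply: tr_combination; exact: kahler_form_tr.
have closedOm al be p q r : partialC p (fun y => Om al be y r q) x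
    + partialC q (fun y => Om al be y p r) x + partialC r (fun y => Om al be y q p) x = 0.
  by apply: (closed_combination _ _ (sk i) (sw i) ix); [exact: ck|exact: cw].
have wvC y : img i y -> complexify (w i y) *m complexify (invmx (w i y)) = 1%:M.
  by move=> iy; rewrite -map_mxM mulmxV ?map_mx1 // hyper_form_unit.
have vwC y : img i y -> complexify (invmx (w i y)) *m complexify (w i y) = 1%:M.
  by move=> iy; rewrite -map_mxM mulVmx ?map_mx1 // hyper_form_unit.
have wIC y : img i y -> complexify (w i y) *m complexify (I i y) = - complexify (k i y).
  by move=> iy; have [E _ _] := hyper_forms iy; rewrite -map_mxM E map_mxN.
have IwC y : img i y -> (complexify (I i y))^T *m complexify (w i y) = - complexify (k i y).
  by move=> iy; have [_ E _] := hyper_forms iy; rewrite map_trmx -map_mxM E map_mxN.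
have IkC y : img i y -> (complexify (I i y))^T *m complexify (k i y) = complexify (w i y).
  by move=> iy; have [_ _ E] := hyper_forms iy; rewrite map_trmx -map_mxM E.
have i2 : 'i%C * 'i%C = -1 :> C by rewrite -expr2 sqr_i.
have sc : (sin t)%:C%C ^+ 2 + (cos t)%:C%C ^+ 2 = 1 :> C.
  by rewrite -!rmorphXn -rmorphD addrC cos2Dsin2 rmorph1.
have two0 : (2 : C) != 0 by rewrite pnatr_eq0.
have -> : complexify (interpolation g I J t i x) =
    block_mx (- (sin t)%:C%C *: complexify (I i x)) (- (cos t)%:C%C *: complexify (invmx (w i x)))
    ((cos t)%:C%C *: complexify (w i x)) ((sin t)%:C%C *: (complexify (I i x))^T).
  by rewrite interpolationE /complexify map_block_mx !map_mxZ !rmorphN map_trmx.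
rewrite courantE.
have [c0|c0] := eqVneq (cos t) 0.
  have s1 : sin t = 1.
    (* Here [sin t] is 1 or -1; the bounds on [t] make it nonnegative and exclude -1. *)
    have := cos2Dsin2 t; rewrite c0 expr0n /= add0r => /eqP.
    rewrite sqrf_eq1 => /orP[/eqP//|/eqP sN1].
    have : 0 <= sin t.
      by apply: sin_ge0_pi; rewrite t0 /= (le_trans tpi) // ler_pdivrMr // ler_peMr ?pi_ge0 // ler1n.
    by rewrite sN1 oppr_ge0 ler10.
  have cC0 : (cos t)%:C%C = 0 :> C by rewrite c0.
  have sC1 : (sin t)%:C%C = 1 :> C by rewrite s1.
  have ker s : plus_i_section (interpolation g I J t) s -> forall y, img i y ->
     Om 1 (- 'i%C) y *m vector_part (s i) y = 0 /\
     form_part (s i) y = Om 1 (- 'i%C) y *m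
       (('i%C / 2) *: (complexify (invmx (w i y)) *m form_part (s i) y)).
    move=> Hs y iy; rewrite /Om /form_combination scale1r scaleNr.
    exact: (eigen_kernel (wvC y iy) (wIC y iy) (IwC y iy) i2 two0 cC0 sC1 (eigen_section Hs iy)).
  pose Om1 := Om 1 (- 'i%C).
  pose Z s y : 'cV[C]_n := ('i%C / 2) *: (complexify (invmx (w i y)) *m form_part (s i) y).
  (* The explicit potential is differentiable because the inverse of [w] is smooth; an arbitrary
     pointwise preimage would not suffice. *)
  have dZ s : smooth_mxC (img i) (s i) -> diffCmx (Z s) x.
    move=> ss p q; under eq_fun do rewrite mxE.
    apply: diffCM; first exact: diffC_cst.
    apply: diffCmx_mulmx (dxi s ss) p q.
    by apply: (diffCmx_complexify (U := img i)) => //; exact: smooth_kahler_inv.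
  have kX s : plus_i_section (interpolation g I J t) s ->
      \forall y \near x, Om1 y *m vector_part (s i) y = 0.
    by move=> Hs; apply: (open_near oi ix) => y iy; have [] := ker s Hs y iy.
  have kxi s : plus_i_section (interpolation g I J t) s ->
      \forall y \near x, form_part (s i) y = Om1 y *m Z s y.
    by move=> Hs; apply: (open_near oi ix) => y iy; have [] := ker s Hs y iy.
  have [E0 ->] := courant_form_kernel (dOm _ _) (OmT _ _) (closedOm _ _)
    (dX a (sa i)) (dX b (sb i)) (dZ a (sa i)) (dZ b (sb i)) (kX a Ha) (kX b Hb) (kxi a Ha) (kxi b Hb).
  move: E0; rewrite /Om1 /Om /form_combination scale1r scaleNr => E0.
  exact: (kernel_eigen (vwC x ix) (wIC x ix) (IwC x ix) (IkC x ix) i2 _ cC0 sC1).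
(* The coefficients in [eigen_graph]; they are constant on the manifold, so the combination remains
   closed. *)
pose al := (sin t)%:C%C / (cos t)%:C%C : C; pose be := - 'i%C / (cos t)%:C%C : C.
have cC0 : (cos t)%:C%C != 0 :> C by rewrite fmorph_eq0.
have graph s : plus_i_section (interpolation g I J t) s -> \forall y \near x,
    form_part (s i) y = Om al be y *m vector_part (s i) y.
  move=> Hs; apply: (open_near oi ix) => y iy.
  apply/(eigen_graph (wvC y iy) (vwC y iy) (wIC y iy) (IwC y iy) (IkC y iy) i2 sc _ _ cC0).
  exact: eigen_section.
(* In the other direction, it suffices that the covector part of the bracket be [Om al be x] applied
   to its vector part. *)
apply/(eigen_graph (wvC x ix) (vwC x ix) (wIC x ix) (IwC x ix) (IkC x ix) i2 sc _ _ cC0).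
exact: (courant_form_graph (dOm al be) (OmT al be) (closedOm al be)
  (dX a (sa i)) (dX b (sb i)) (graph a Ha) (graph b Hb)).
Qed.

End Hyperkahler.

Theorem proposition4p34 (R : realType) (n : nat) (M : manifold R n)
    (g I J K : @components R n M 'M[R]_n)
    (hK : is_hyperkahler g I J K) :
  (forall t : R, 0 <= t <= pi / 2 -> is_gen_complex (interpolation g I J t))
  /\ (is_symplectic_form (kahler_form g J)
      /\ interpolation g I J 0 = gen_of_symplectic (kahler_form g J))
  /\ (is_complex_structure I
      /\ interpolation g I J (pi / 2) = gen_of_complex I).
Proof.
split; [|split; split].
- move=> t tI; split; first exact: (interpolation_almost_complex hK).
  exact: (interpolation_integrable hK).
- exact: (hyper_symplectic hK).
- apply/funext => i; apply/funext => x.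
  by rewrite /interpolation sin0 cos0 scale0r add0r scale1r.
- by case: hK => -[].
- apply/funext => i; apply/funext => x.
  by rewrite /interpolation sin_pihalf cos_pihalf scale1r scale0r addr0.
Qed.
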